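(* Let $A,B\in \mathrm{PU}(2,1)$ be two isometries of $\mathrm{H}^2_{\mathbb{C}}$ having no common fixed point in $\overline{\mathrm{H}^2_{\mathbb{C}}}$. Then the pair $(A,B)$ is $\mathbb{R}$-decomposable if and only if the commutator $[A,B]$ has a fixed point in $\overline{\mathrm{H}^2_{\mathbb{C}}}$ whose associated eigenvalue is real and positive.
   Context: Let $\mathbb{C}^{2,1}$ be $\mathbb{C}^3$ with a Hermitian form $\langle\cdot,\cdot\rangle$ of signature $(2,1)$. The complex hyperbolic plane $\mathrm{H}^2_{\mathbb{C}}\subset\mathbb{C}P^2$ is the set of lines spanned by vectors $Z$ with $\langle Z,Z\rangle<0$, with metric $\cosh^2\frac12 d(\pi(X),\pi(Y))=\frac{|\langle X,Y\rangle|^2}{\langle X,X\rangle\langle Y,Y\rangle}$; its boundary $\partial \mathrm{H}^2_{\mathbb{C}}$ is the set of null lines and $\overline{\mathrm{H}^2_{\mathbb{C}}}=\mathrm{H}^2_{\mathbb{C}}\cup\partial\mathrm{H}^2_{\mathbb{C}}$. $\mathrm{PU}(2,1)$ is the group of holomorphic isometries of $\mathrm{H}^2_{\mathbb{C}}$. A real plane is the projective image in $\mathrm{H}^2_{\mathbb{C}}$ of a totally real subspace $W\subset\mathbb{C}^{2,1}$ of real dimension 3 (i.e. $\langle v,w\rangle\in\mathbb{R}$ for all $v,w\in W$) that meets the negative vectors. Each real plane is the fixed-point set of a unique antiholomorphic isometric involution, called a real reflection; all real reflections are conjugate under $\mathrm{PU}(2,1)$ to $(z_1,z_2)\mapsto(\overline{z_1},\overline{z_2})$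 in the unit ball model. A pair $(A,B)\in\mathrm{PU}(2,1)^2$ is $\mathbb{R}$-decomposable if there exist real reflections $\sigma_1,\sigma_2,\sigma_3$ such that $A=\sigma_1\sigma_2$ and $B=\sigma_1\sigma_3$. For lifts $\tilde A,\tilde B\in\mathrm{U}(2,1)$ of $A,B$, the matrix $[\tilde A,\tilde B]=\tilde A\tilde B\tilde A^{-1}\tilde B^{-1}$ does not depend on the choice of lifts; eigenvalues of $[A,B]$ mean eigenvalues of this matrix. The eigenvalue associated to a fixed point $p$ of $[A,B]$ is the $\lambda$ with $[\tilde A,\tilde B]P=\lambda P$ for any lift $P\in\mathbb{C}^{2,1}$ of $p$. *)

(* Defs.v *)
From HB Require Import structures.
From mathcomp Require Import all_boot all_order all_algebra.
From mathcomp Require Import complex.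
From mathcomp Require Import all_classical all_reals all_analysis.

Set Implicit Arguments.
Unset Strict Implicit.
Unset Printing Implicit Defensive.

Import Order.TTheory GRing.Theory Num.Theory.
Import numFieldNormedType.Exports.
Local Open Scope classical_set_scope.
Local Open Scope quotient_scope.
Local Open Scope ring_scope.
Local Open Scope sesquilinear_scope.

(* [R[i]] packed as a [numClosedFieldType]: the norm topology used by
   [differentiable] is found on the sort of the packed structure, but not on
   the bare type [R[i]].  A hypothesis [0 < z] in this type says that [z] is
   real and positive. *)
Definition Cplx (R : realType) : numClosedFieldType := R[i].

Definition RtoC (R : realType) (x : R) : Cplx R := (x%:C)%C.

Definition commutator (G : groupType) (x y : G) : G :=
  (x * y * x^-1 * y^-1)%g.

Definition cosh (R : realType) (x : R) : R := (expR x + expR (- x)) / 2.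

Definition arccosh (R : realType) (x : R) : R := ln (x + Num.sqrt (x ^+ 2 - 1)).

Lemma arccoshK (R : realType) (x : R) : 1 <= x -> cosh (arccosh x) = x.
Proof.
move=> x1; have x0 : 0 < x by apply: lt_le_trans x1.
have s2 : Num.sqrt (x ^+ 2 - 1) ^+ 2 = x ^+ 2 - 1.
  by rewrite sqr_sqrtr // subr_ge0 expr_ge1 // ltW.
have s0 : 0 <= Num.sqrt (x ^+ 2 - 1) by apply: sqrtr_ge0.
rewrite /cosh /arccosh expRN lnK ?posrE ?ltr_wpDr //.
set s := Num.sqrt _ in s2 s0 *.
have xs0 : x + s != 0 by rewrite gt_eqF // ltr_wpDr.
have -> : (x + s)^-1 = x - s.
  apply: (mulfI xs0); rewrite mulfV // mulrC -subr_sqr s2.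
  by rewrite opprB addrCA subrr addr0.
by rewrite addrACA subrr addr0 -mulr2n -[x *+ 2]mulr_natr mulfK.
Qed.

Lemma arccosh_ge0 (R : realType) (x : R) : 1 <= x -> 0 <= arccosh x.
Proof. by move=> x1; apply: ln_ge0; rewrite ler_wpDr // sqrtr_ge0. Qed.

Section ComplexHyperbolicPlane.
Variable R : realType.
Local Notation C := (Cplx R).
Implicit Type J : 'M[C]_3.

(* Linear in the first argument, conjugate-linear in the second. *)
Definition hform J (X Y : 'cV[C]_3) : C := (Y ^t Num.conj *m J *m X) 0 0.

Definition signature21 J : Prop :=
  J \is hermsymmx /\
  exists2 P : 'M[C]_3, P \in unitmx &
    P ^t Num.conj *m J *m P = diag_mx (\row_i (if i == ord_max then -1 else 1)).

Record CP2 := MkCP2 {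
  line :> {vspace 'cV[C]_3};
  dim_line : \dim line == 1%N }.
HB.instance Definition _ := [isSub for line].
HB.instance Definition _ := [Choice of CP2 by <:].

Definition H2 J : set CP2 :=
  [set p | exists2 Z, hform J Z Z < 0 & line p = <[Z]>%VS].

Definition bdH2 J : set CP2 :=
  [set p | exists2 Z, Z != 0 /\ hform J Z Z = 0 & line p = <[Z]>%VS].

Definition clH2 J : set CP2 := H2 J `|` bdH2 J.

Section Group.
Variable J : 'M[C]_3.

Definition unitary21 (M : 'M[C]_3) : bool :=
  (M \in unitmx) && (M ^t Num.conj *m J *m M == J).

Record U21 := MkU21 { U21mx :> 'M[C]_3; U21P : unitary21 U21mx }.
HB.instance Definition _ := [isSub for U21mx].
HB.instance Definition _ := [Choice of U21 by <:].

Lemma unitary21_1 : unitary21 1%:M.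
Proof.
by rewrite /unitary21 unitmx1 trmx1 map_mx1 mul1mx mulmx1 eqxx.
Qed.

Lemma unitary21M (M N : U21) : unitary21 (M *m N).
Proof.
case/andP: (U21P M) => uM /eqP eM; case/andP: (U21P N) => uN /eqP eN.
rewrite /unitary21 unitmx_mul uM uN /= trmx_mul map_mxM.
by rewrite !mulmxA -(mulmxA _ _ J) -(mulmxA _ _ (U21mx M)) eM eN.
Qed.

Lemma unitary21V (M : U21) : unitary21 (invmx M).
Proof.
case/andP: (U21P M) => uM /eqP eM.
rewrite /unitary21 unitmx_inv uM /= -[X in _ *m X *m _]eM !mulmxA.
by rewrite -map_mxM -trmx_mul mulmxV // trmx1 map_mx1 mul1mx mulmxK.
Qed.

Definition U21_one := MkU21 unitary21_1.
Definition U21_mul M N := MkU21 (unitary21M M N).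
Definition U21_inv M := MkU21 (unitary21V M).

Lemma U21_mulA : associative U21_mul.
Proof. by move=> x y z; apply: val_inj; rewrite /= mulmxA. Qed.
Lemma U21_mul1 : left_id U21_one U21_mul.
Proof. by move=> x; apply: val_inj; rewrite /= mul1mx. Qed.
Lemma U21_mulr1 : right_id U21_one U21_mul.
Proof. by move=> x; apply: val_inj; rewrite /= mulmx1. Qed.
Lemma U21_mulV : left_inverse U21_one U21_inv U21_mul.
Proof.
by move=> x; apply: val_inj; rewrite /= mulVmx //; case/andP: (U21P x).
Qed.
Lemma U21_mulrV : right_inverse U21_one U21_inv U21_mul.
Proof.
by move=> x; apply: val_inj; rewrite /= mulmxV //; case/andP: (U21P x).
Qed.
HB.instance Definition _ := isGroup.Build U21
  U21_mulA U21_mul1 U21_mulr1 U21_mulV U21_mulrV.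

Definition proportional (M N : U21) : bool :=
  `[< exists c : C, U21mx M = c *: U21mx N >].

Lemma proportional_refl : reflexive proportional.
Proof. by move=> M; apply/asboolP; exists 1; rewrite scale1r. Qed.

Lemma U21_neq0 (M : U21) : U21mx M != 0.
Proof.
apply/eqP => M0; case/andP: (U21P M); rewrite M0 unitmxE det0 unitr0 //.
Qed.

Lemma proportional_impl M N : proportional M N -> proportional N M.
Proof.
move=> /asboolP [c McN]; apply/asboolP; exists c^-1.
have c0 : c != 0.
  by apply: contraNneq (U21_neq0 M) => c0; rewrite McN c0 scale0r.
by rewrite McN scalerA mulVf // scale1r.
Qed.

Lemma proportional_sym : symmetric proportional.
Proof. by move=> M N; apply/idP/idP; exact: proportional_impl. Qed.

Lemma proportional_trans : transitive proportional.
Proof.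
move=> N M K /asboolP [c McN] /asboolP [d NdK]; apply/asboolP.
by exists (c * d); rewrite McN NdK scalerA.
Qed.

Canonical proportional_equiv :=
  EquivRel proportional proportional_refl proportional_sym proportional_trans.

Definition PU21 := {eq_quot proportional_equiv}%qT.
HB.instance Definition _ := Choice.on PU21.
HB.instance Definition _ := EqQuotient.on PU21.

Definition toPU (M : U21) : PU21 := \pi_PU21 M.

Lemma toPU_eq M N :
  toPU M = toPU N <-> exists c : C, U21mx M = c *: U21mx N.
Proof.
split; first by move=> /eqmodP /asboolP.
by move=> h; apply/eqmodP/asboolP.
Qed.

Lemma toPU_surj (A : PU21) : exists M, toPU M = A.
Proof. by exists (repr A); rewrite /toPU reprK. Qed.

Definition PU_one : PU21 := toPU 1%g.
Definition PU_mul (A B : PU21) : PU21 := toPU (repr A * repr B)%g.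
Definition PU_inv (A : PU21) : PU21 := toPU (repr A)^-1%g.

Lemma repr_toPU M : exists c : C, U21mx (repr (toPU M)) = c *: U21mx M.
Proof. by apply/toPU_eq; rewrite /toPU reprK. Qed.

Lemma PU_mulE M N : PU_mul (toPU M) (toPU N) = toPU (M * N)%g.
Proof.
apply/toPU_eq; have [c hc] := repr_toPU M; have [d hd] := repr_toPU N.
by exists (c * d); rewrite /= hc hd -scalemxAl -scalemxAr scalerA.
Qed.

Lemma PU_invE M : PU_inv (toPU M) = toPU M^-1%g.
Proof.
apply/toPU_eq; have [c hc] := repr_toPU M; exists c^-1 => /=.
by rewrite hc invmxZ // -hc; case/andP: (U21P (repr (toPU M))).
Qed.

Lemma PU_mulA : associative PU_mul.
Proof.
move=> A B D; have [[M <-] [[N <-] [K <-]]] :=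
  (toPU_surj A, (toPU_surj B, toPU_surj D)).
by rewrite !PU_mulE mulgA.
Qed.
Lemma PU_mul1 : left_id PU_one PU_mul.
Proof. by move=> A; have [M <-] := toPU_surj A; rewrite PU_mulE mul1g. Qed.
Lemma PU_mulr1 : right_id PU_one PU_mul.
Proof. by move=> A; have [M <-] := toPU_surj A; rewrite PU_mulE mulg1. Qed.
Lemma PU_mulV : left_inverse PU_one PU_inv PU_mul.
Proof.
by move=> A; have [M <-] := toPU_surj A; rewrite PU_invE PU_mulE mulVg.
Qed.
Lemma PU_mulrV : right_inverse PU_one PU_inv PU_mul.
Proof.
by move=> A; have [M <-] := toPU_surj A; rewrite PU_invE PU_mulE mulgV.
Qed.
HB.instance Definition _ := isGroup.Build PU21
  PU_mulA PU_mul1 PU_mulr1 PU_mulV PU_mulrV.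

Lemma toPUM M N : toPU (M * N)%g = (toPU M * toPU N)%g.
Proof. by rewrite -PU_mulE. Qed.
Lemma toPUV M : toPU M^-1%g = (toPU M)^-1%g.
Proof. by rewrite -PU_invE. Qed.

Lemma dim_U21_line (M : U21) (p : CP2) : \dim (linfun (mulmx M) @: p)%VS == 1%N.
Proof.
rewrite limg_dim_eq; first exact: dim_line.
suff /eqP -> : lker (linfun (mulmx M : 'cV[C]_3 -> 'cV[C]_3)) == 0%VS
  by rewrite capv0.
apply/lker0P => X Y; rewrite !lfunE /= => MXY.
case/andP: (U21P M) => uM _.
by rewrite -(mulKmx uM X) MXY mulKmx.
Qed.

Definition U21_act (M : U21) (p : CP2) : CP2 := MkCP2 (dim_U21_line M p).

Definition act (A : PU21) (p : CP2) : CP2 := U21_act (repr A) p.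

Lemma U21_act_span (M : U21) (p : CP2) (Z : 'cV[C]_3) :
  line p = <[Z]>%VS -> line (U21_act M p) = <[U21mx M *m Z]>%VS.
Proof. by move=> /= ->; rewrite limg_line lfunE. Qed.

Lemma act_toPU (M : U21) (p : CP2) : act (toPU M) p = U21_act M p.
Proof.
apply: val_inj; have [c hc] := repr_toPU M.
have [Z pZ] : exists Z, line p = <[Z]>%VS.
  exists (vpick p); apply/esym/eqP; rewrite eqEdim -memvE memv_pick.
  rewrite (eqP (dim_line p)) dim_vline lt0b vpick0 -dimv_eq0.
  by rewrite (eqP (dim_line p)).
rewrite [LHS](U21_act_span _ pZ) [RHS](U21_act_span M pZ) hc -scalemxAl.
have c0 : c != 0.
  apply: contraNneq (U21_neq0 (repr (toPU M))) => c0.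
  by rewrite hc c0 scale0r.
apply/eqP; rewrite eqEsubv -!memvE memvZ ?memv_line //=.
by rewrite -[X in X \in _](scalerK c0) memvZ // memv_line.
Qed.

Lemma commutator_lift (M N M' N' : U21) :
  toPU M = toPU M' -> toPU N = toPU N' -> commutator M N = commutator M' N'.
Proof.
have neq0 (K K' : U21) (c : C) : U21mx K = c *: U21mx K' -> c != 0.
  by move=> h; apply: contraNneq (U21_neq0 K) => c0; rewrite h c0 scale0r.
have invZ (K K' : U21) (c : C) :
    U21mx K = c *: U21mx K' -> invmx (U21mx K) = c^-1 *: invmx (U21mx K').
  by move=> h; rewrite h invmxZ // -h; case/andP: (U21P K).
move=> /toPU_eq [c hM] /toPU_eq [d hN]; apply: val_inj => /=.
rewrite (invZ _ _ _ hM) (invZ _ _ _ hN) hM hN.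
rewrite -!(scalemxAl, scalemxAr) !scalerA.
rewrite [d^-1 / c * d]mulrAC mulVf ?(neq0 _ _ _ hN) // mul1r.
by rewrite mulfV ?(neq0 _ _ _ hM) // scale1r.
Qed.

(* The eigenvalue associated to p is computed on any lifts; these exist by
   [toPU_surj], and the matrix does not depend on them by [commutator_lift]. *)
Definition commutator_eigenvalue (A B : PU21) (p : CP2) (lam : C) : Prop :=
  forall MA MB : U21, toPU MA = A -> toPU MB = B ->
  forall P : 'cV[C]_3, P != 0 -> P \in line p ->
    U21mx (commutator MA MB) *m P = lam *: P.

Definition cosh2_half_ratio (X Y : 'cV[C]_3) : R :=
  complex.Re (`|hform J X Y| ^+ 2 / (hform J X X * hform J Y Y) : C).

(* [vpick p] is a nonzero vector of the line [p]. *)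
Definition dist (p q : H2 J) : R :=
  2 * arccosh (Num.sqrt (cosh2_half_ratio (vpick (\val p)) (vpick (\val q)))).

Definition isometric (f : H2 J -> H2 J) : Prop :=
  forall p q, dist (f p) (f q) = dist p q.

(* The projection from the negative vectors onto the hyperbolic plane is a
   holomorphic submersion, so [f] is antiholomorphic iff near each negative
   vector it lifts to an antiholomorphic vector-valued map [F], that is, to
   a map whose complex conjugate is complex-differentiable. *)
Definition antiholomorphic (f : H2 J -> H2 J) : Prop :=
  forall Z : 'cV[C]_3, hform J Z Z < 0 ->
  exists F : 'cV[C]_3 -> 'cV[C]_3,
    \forall Y \near Z,
      differentiable (fun X => (F X) ^ Num.conj) Y /\
      forall p : H2 J, line (\val p) = <[Y]>%VS ->
        line (\val (f p)) = <[F Y]>%VS.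

Definition real_subspace3 (W : set 'cV[C]_3) : Prop :=
  exists w : 'I_3 -> 'cV[C]_3,
    (forall a : 'I_3 -> R, \sum_i RtoC (a i) *: w i = 0 -> forall i, a i = 0)
    /\ W = [set v | exists a : 'I_3 -> R, v = \sum_i RtoC (a i) *: w i].

Definition totally_real (W : set 'cV[C]_3) : Prop :=
  forall v w, W v -> W w -> hform J v w \is Num.real.

Definition real_plane (L : set (H2 J)) : Prop :=
  exists W : set 'cV[C]_3,
    [/\ real_subspace3 W, totally_real W,
        exists2 v, W v & hform J v v < 0 &
        L = [set p | exists2 v, W v & line (\val p) = <[v]>%VS]].

Definition real_reflection (s : H2 J -> H2 J) : Prop :=
  [/\ antiholomorphic s, isometric s, involutive s &
      real_plane [set p | s p = p]].

Definition R_decomposable (A B : PU21) : Prop :=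
  exists s1 s2 s3 : H2 J -> H2 J,
    [/\ real_reflection s1, real_reflection s2, real_reflection s3,
        forall p : H2 J, act A (\val p) = \val (s1 (s2 p)) &
        forall p : H2 J, act B (\val p) = \val (s1 (s3 p))].

End Group.
End ComplexHyperbolicPlane.

(* Main.v *)
Require Import Defs.
From HB Require Import structures.
From mathcomp Require Import all_boot all_order all_algebra.
From mathcomp Require Import complex.
From mathcomp Require Import all_classical all_reals all_analysis.
From mathcomp Require Import ring.

Set Implicit Arguments.
Unset Strict Implicit.
Unset Printing Implicit Defensive.

Import Order.TTheory GRing.Theory Num.Theory.
Import numFieldNormedType.Exports.
Local Open Scope classical_set_scope.
Local Open Scope ring_scope.

(** Call an antilinear map [T] antiunitary if [h (T x) (T y)] is the conjugate
    of [h x y], where [h] is the Hermitian form.  Real reflections are exactly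
    the maps of the hyperbolic plane induced by antiunitary involutions
    ([anti_lift_real_reflection], [real_reflection_lift]), which turns both
    directions into linear algebra.

    Suppose that [A = s1 s2] and [B = s1 s3].  For any lifts, the commutator is
    the square of the antiunitary map [T = s1 s2 s1 s3 s1].  The isometry [T^2]
    has an eigenvector [v] with [h v v <= 0], because the form has no three
    pairwise orthogonal positive vectors, and comparing [v] with [T v] shows
    that the eigenvalue is positive ([antiunitary_pos_eigenvector]).

    Conversely, let [v1] be a nonpositive eigenvector of the commutator with
    eigenvalue [r * r > 0], and put [v2 = B^-1 v1], [v3 = A^-1 v2] and
    [v4 = A^-1 v1], so that [B v3 = r * r *: v4].  Positivity of the eigenvalue
    is what makes the Gram matrix of [r v1], [r^-1 v2], [r^-1 v3], [r v4]
    conjugate to that of [v3], [v4], [v1], [v2].  By an analogue of Witt's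
    theorem ([antiunitary_extension]) there is an antiunitary [S] that
    exchanges opposite vertices of the square [v1 v2 v3 v4] in this way.  Each
    of [S^2], [(S A)^2], [(S B)^2] fixes two vertices, and an antiunitary map
    whose square fixes two independent nonpositive vectors is an involution,
    since its square has determinant 1 ([antiunitary_involution]).  Hence [S],
    [S A], [S B] induce real reflections, and [A = S (S A)], [B = S (S B)].

    When adjacent vertices coincide, only two points of the square remain, both
    fixed by [A] or both fixed by [B]; they are distinct because [A] and [B]
    have no common fixed point.  The values of [S] at the two points leave its
    phase on the normal of their plane free, and this phase is chosen so as to
    make the third map an involution ([inverting_of_collapsed_square]). *)

(** * Sesquilinear algebra *)

Lemma ord3_ind (P : 'I_3 -> Prop) : P 0 -> P 1 -> P 2 -> forall i, P i.
Proof.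
move=> p0 p1 p2 [[|[|[|//]]] ilt].
- by rewrite (_ : Ordinal ilt = 0) //; exact: val_inj.
- by rewrite (_ : Ordinal ilt = 1) //; exact: val_inj.
- by rewrite (_ : Ordinal ilt = 2) //; exact: val_inj.
Qed.

(** Generalizing the values of the form keeps [ring] from comparing them by
    unfolding matrix products. *)
Ltac form_ring :=
  repeat match goal with
  | |- context [hform ?J ?x ?y] => generalize (hform J x y); intro
  end; ring.

Section HermitianForm.
Variables (R : realType) (J : 'M[Cplx R]_3).
Local Notation C := (Cplx R).
Local Notation h := (hform J).
Local Notation "M ^c" := (map_mx Num.conj M).
Implicit Types (a b c : C) (x y z : 'cV[C]_3) (M N : 'M[C]_3).

Lemma hformDl x y z : h (x + y) z = h x z + h y z.
Proof. by rewrite /hform mulmxDr mxE. Qed.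

Lemma hformZl a x z : h (a *: x) z = a * h x z.
Proof. by rewrite /hform -scalemxAr mxE. Qed.

Lemma hformDr x y z : h z (x + y) = h z x + h z y.
Proof. by rewrite /hform linearD map_mxD !mulmxDl mxE. Qed.

Lemma hformZr a x z : h z (a *: x) = a^* * h z x.
Proof. by rewrite /hform linearZ /= map_mxZ -!scalemxAl mxE. Qed.

Lemma hformNl x z : h (- x) z = - h x z.
Proof. by rewrite -scaleN1r hformZl mulN1r. Qed.

Lemma hformNr x z : h z (- x) = - h z x.
Proof. by rewrite -scaleN1r hformZr rmorphN rmorph1 mulN1r. Qed.

Lemma hform0l x : h 0 x = 0.
Proof. by rewrite -(scale0r 0) hformZl mul0r. Qed.

Lemma hform0r x : h x 0 = 0.
Proof. by rewrite -(scale0r 0) hformZr conjC0 mul0r. Qed.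

Definition hformE := (hformDl, hformDr, hformZl, hformZr, hformNl, hformNr).

Lemma conjmxK m n (A : 'M[C]_(m, n)) : A^c^c = A.
Proof. by apply/matrixP => i j; rewrite !mxE conjCK. Qed.

Lemma conjmx_inj m n : injective (fun A : 'M[C]_(m, n) => A^c).
Proof. exact: can_inj (@conjmxK m n). Qed.

Lemma conjmx_mul m n p (A : 'M[C]_(m, n)) (B : 'M[C]_(n, p)) :
  (A *m B)^c = A^c *m B^c.
Proof. exact: map_mxM. Qed.

Lemma conjmx_invmx M : (invmx M)^c = invmx M^c.
Proof. exact: map_invmx. Qed.

Lemma conjmx_unit M : (M^c \in unitmx) = (M \in unitmx).
Proof. exact: map_unitmx. Qed.

Lemma conjmx_det M : \det M^c = (\det M)^*.
Proof. exact: det_map_mx. Qed.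

Definition isometry M : Prop := M^T^c *m J *m M = J.
Definition antiunitary M : Prop := M^T^c *m J *m M = J^c.

(** Antilinear maps are encoded by matrices, so that [antiunitary M] says that
    [anti M] conjugates the form ([hform_antiunitary]) and the composite of
    [anti M] and [anti N] is the linear map of [M *m N^c]. *)
Definition anti M x : 'cV[C]_3 := M *m x^c.

Lemma antiD M x y : anti M (x + y) = anti M x + anti M y.
Proof. by rewrite /anti map_mxD mulmxDr. Qed.

Lemma antiZ M a x : anti M (a *: x) = a^* *: anti M x.
Proof. by rewrite /anti map_mxZ -scalemxAr. Qed.

Lemma antiN M x : anti M (- x) = - anti M x.
Proof. by rewrite -scaleN1r antiZ rmorphN1 scaleN1r. Qed.

Lemma anti_anti M N x : anti M (anti N x) = M *m N^c *m x.
Proof. by rewrite /anti conjmx_mul conjmxK mulmxA. Qed.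

Lemma anti_mul M N x : anti M (N *m x) = anti (M *m N^c) x.
Proof. by rewrite /anti conjmx_mul mulmxA. Qed.

Lemma hform_isometry M x y : isometry M -> h (M *m x) (M *m y) = h x y.
Proof.
by move=> hM; rewrite /hform trmx_mul conjmx_mul -{2}hM !mulmxA.
Qed.

Lemma isometry_unitary21 (M : U21 J) : isometry M.
Proof. by case/andP: (U21P M) => _ /eqP. Qed.

Lemma U21_unit (M : U21 J) : U21mx M \in unitmx.
Proof. by case/andP: (U21P M). Qed.

Lemma antiunitary_mulr M N :
  antiunitary M -> isometry N -> antiunitary (M *m N^c).
Proof.
rewrite /antiunitary /isometry => hM hN.
rewrite trmx_mul conjmx_mul map_trmx conjmxK !mulmxA.
rewrite -(mulmxA (N^T) _ J) -(mulmxA N^T) hM -[in RHS]hN.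
by rewrite !conjmx_mul conjmxK.
Qed.

Lemma antiunitary_mul_conj M N :
  antiunitary M -> antiunitary N -> isometry (M *m N^c).
Proof.
rewrite /antiunitary /isometry => hM hN.
rewrite trmx_mul conjmx_mul map_trmx conjmxK !mulmxA.
rewrite -(mulmxA (N^T) _ J) -(mulmxA N^T) hM.
by apply: conjmx_inj; rewrite /= !conjmx_mul !conjmxK.
Qed.

Lemma isometry_mul M N : isometry M -> isometry N -> isometry (M *m N).
Proof.
rewrite /isometry => hM hN.
by rewrite trmx_mul conjmx_mul !mulmxA -(mulmxA _ _ J) -(mulmxA _ _ M) hM.
Qed.

Lemma isometry_anti_mul M N :
  isometry M -> antiunitary N -> antiunitary (M *m N).
Proof.
rewrite /antiunitary /isometry => hM hN.
by rewrite trmx_mul conjmx_mul !mulmxA -(mulmxA _ _ J) -(mulmxA _ _ M) hM.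
Qed.

(** Everything below rests on one feature of signature (2,1): the orthogonal
    complement of a negative vector is positive definite. *)
Section Signature.
Hypothesis hJ : signature21 J.

Lemma hformC x y : h x y = (h y x)^*.
Proof.
case: hJ => /is_hermitianmxP; rewrite expr0 scale1r => hh _.
rewrite /hform [in LHS]hh.
have -> (A : 'M[C]_1) : (A 0 0)^* = (A^T^c) 0 0 by rewrite !mxE.
by rewrite !trmx_mul !conjmx_mul map_trmx conjmxK trmxK mulmxA.
Qed.

Lemma hform_real x : h x x \is Num.real.
Proof. by rewrite CrealE -hformC. Qed.

Lemma form_unitmx : J \in unitmx.
Proof.
case: hJ => _ [P uP eP]; rewrite unitmxE unitfE.
have: \det (P^T^c *m J *m P) != 0.
  rewrite eP det_diag; apply/prodf_neq0 => i _; rewrite mxE.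
  by case: ifP => _; rewrite ?oppr_eq0 oner_eq0.
by rewrite !det_mulmx !mulf_eq0 !negb_or => /andP [/andP[]].
Qed.

(** Taking determinants in the definition gives [`|\det M| ^+ 2 = 1]. *)
Lemma antiunitary_det M : antiunitary M -> \det (M *m M^c) = 1.
Proof.
move=> /(congr1 determinant); rewrite !det_mulmx !conjmx_det det_tr.
have dJ : (\det J)^* = \det J.
  case: hJ => /is_hermitianmxP; rewrite expr0 scale1r => hh _.
  by rewrite [in RHS]hh conjmx_det det_tr.
have dJ0 : \det J != 0 by rewrite -unitfE -unitmxE form_unitmx.
by rewrite dJ mulrAC [X in X * _]mulrC => /(canRL (mulfK dJ0)) ->; rewrite mulfV.
Qed.

Lemma antiunitary_unit M : antiunitary M -> M \in unitmx.
Proof.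
move=> /antiunitary_det; rewrite det_mulmx unitmxE unitfE => d1.
by apply: contra_eq_neq d1 => ->; rewrite mul0r eq_sym oner_eq0.
Qed.

Lemma hform_antiunitary M x y :
  antiunitary M -> h (anti M x) (anti M y) = (h x y)^*.
Proof.
move=> hM; rewrite /hform /anti trmx_mul conjmx_mul.
have -> (A : 'M[C]_1) : (A 0 0)^* = A^c 0 0 by rewrite !mxE.
by rewrite !conjmx_mul -hM !map_trmx !mulmxA.
Qed.

(** By the Cauchy-Schwarz inequality in diagonalizing coordinates. *)
Lemma orth_neg_pos x z : h z z < 0 -> h x z = 0 -> x != 0 -> 0 < h x x.
Proof.
case: hJ => _ [P uP eP].
have hP u v : h (P *m u) (P *m v) =
    u 0 0 * (v 0 0)^* + u 1 0 * (v 1 0)^* - u 2 0 * (v 2 0)^*.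
  rewrite /hform trmx_mul conjmx_mul.
  rewrite !mulmxA -(mulmxA _ _ J) -(mulmxA _ _ P) eP.
  rewrite mxE !big_ord_recl big_ord0 mul_mx_diag !mxE /=.
  have -> : lift 0 0 = 1 :> 'I_3 by apply: val_inj.
  have -> : lift 0 (lift 0 0) = 2 :> 'I_3 by apply: val_inj.
  ring.
rewrite -[x](mulKVmx uP) -[z](mulKVmx uP) !hP.
move: (invmx P *m x) (invmx P *m z) => u v.
set a := u 0 0; set b := u 1 0; set c := u 2 0.
set d := v 0 0; set e := v 1 0; set f := v 2 0.
rewrite !subr_lt0 => vneg uv0 u0.
have cf : c * f^* = a * d^* + b * e^* by apply/esym/eqP; rewrite -subr_eq0 uv0.
have cf' : c^* * f = a^* * d + b^* * e.
  by move/(congr1 Num.conj): cf; rewrite rmorphD !rmorphM /= !conjCK.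
have f0 : 0 < f * f^*.
  by apply: le_lt_trans vneg; rewrite addr_ge0 // mul_conjC_ge0.
have A0 : 0 < a * a^* + b * b^*.
  rewrite lt_def addr_ge0 ?mul_conjC_ge0 // andbT.
  apply: contra u0; rewrite paddr_eq0 ?mul_conjC_ge0 // !mul_conjC_eq0.
  case/andP => /eqP a0 /eqP b0; move: cf; rewrite a0 b0 !mul0r addr0 => /eqP.
  have fn0 : f != 0 by apply: contraTneq f0 => ->; rewrite mul0r ltxx.
  rewrite mulf_eq0 conjC_eq0 (negPf fn0) orbF => /eqP c0; apply/eqP.
  suff -> : u = 0 by rewrite mulmx0.
  apply/colP => i; rewrite mxE; case: i => [[|[|[|//]]] ilt].
  - by rewrite -[RHS]a0; congr (u _ _); apply: val_inj.
  - by rewrite -[RHS]b0; congr (u _ _); apply: val_inj.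
  - by rewrite -[RHS]c0; congr (u _ _); apply: val_inj.
rewrite -(pmulr_rgt0 _ f0).
have -> : f * f^* * (a * a^* + b * b^* - c * c^*) =
   (a * a^* + b * b^*) * (f * f^* - (d * d^* + e * e^*))
    + (a * e - b * d) * (a * e - b * d)^*.
  rewrite rmorphB !rmorphM /=.
  transitivity (f * f^* * (a * a^* + b * b^*) - (c * f^*) * (c^* * f)).
    by ring.
  by rewrite cf cf'; ring.
by rewrite ltr_wpDr ?mul_conjC_ge0 // mulr_gt0 // subr_gt0.
Qed.

Lemma negative_vector : exists z, h z z < 0.
Proof.
case: hJ => _ [P uP eP]; exists (P *m delta_mx ord_max 0).
rewrite /hform trmx_mul conjmx_mul !mulmxA -(mulmxA _ _ J) -(mulmxA _ _ P) eP.
rewrite trmx_delta map_delta_mx -rowE -colE !mxE eqxx mulr1n.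
by rewrite oppr_lt0 ltr01.
Qed.

(** Subtract from [y] the multiple of [x] that makes it orthogonal to some
    negative vector: the difference is nonpositive, hence zero. *)
Lemma nonpos_orth_colinear x y :
  x != 0 -> h x x <= 0 -> h y y <= 0 -> h x y = 0 -> exists c, y = c *: x.
Proof.
move=> x0 hx hy xy; have [z hz] := negative_vector.
have xz : h x z != 0.
  by apply/eqP => xz; have := orth_neg_pos hz xz x0; rewrite le_gtF.
exists (h y z / h x z); apply/eqP; rewrite -subr_eq0.
set c := _ / _; apply/negPn/negP => w0.
have := orth_neg_pos hz _ w0.
rewrite !hformE {1}/c divfK // subrr => /(_ erefl).
have yx : h y x = 0 by rewrite hformC xy conjC0.
rewrite xy yx !mulr0 subr0 oppr0 add0r mulrN opprK mulrA le_gtF //.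
by rewrite -[0]addr0 lerD // mulr_ge0_le0 ?mul_conjC_ge0.
Qed.

(** Two vectors span at most a plane, so that a third direction is orthogonal
    to both; if they are eigenvectors of an isometry, it preserves this
    orthogonal complement and has an eigenvector there.  Zero vectors are
    allowed, for fewer constraints. *)
Lemma orthogonal_eigenvector M v w a b : isometry M -> M \in unitmx ->
  M *m v = a *: v -> M *m w = b *: w ->
  exists u c, [/\ u != 0, M *m u = c *: u, h u v = 0 & h u w = 0].
Proof.
move=> hM uM hv hw.
have stab x d u : M *m x = d *: x -> h u x = 0 -> h (M *m u) x = 0.
  move=> hx ux; have := hform_isometry u x hM; rewrite hx hformZr ux => /eqP.
  rewrite mulf_eq0 conjC_eq0 => /orP [/eqP d0 | /eqP //].
  suff -> : x = 0 by rewrite hform0r.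
  by rewrite -(mulKmx uM x) hx d0 scale0r mulmx0.
pose K := kermx (row_mx (v^T^c *m J)^T (w^T^c *m J)^T).
have KP (r : 'rV_3) : (r <= K)%MS = (h r^T v == 0) && (h r^T w == 0).
  rewrite sub_kermx mul_mx_row row_mx_eq0; congr (_ && _).
    rewrite -trmx_eq0 trmx_mul trmxK /hform.
    by apply/eqP/eqP => [->|e]; [rewrite mxE | apply/matrixP=> i j; rewrite !ord1 e mxE].
  rewrite -trmx_eq0 trmx_mul trmxK /hform.
  by apply/eqP/eqP => [->|e]; [rewrite mxE | apply/matrixP=> i j; rewrite !ord1 e mxE].
have K0 : (0 < \rank K)%N.
  rewrite mxrank_ker subn_gt0; exact: leq_ltn_trans (rank_leq_col _) _.
pose B := row_base K.
have BM : (B *m M^T <= B)%MS.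
  apply/row_subP => i; rewrite row_mul eq_row_base KP !trmx_mul !trmxK.
  have : (row i B <= K)%MS by rewrite -(eq_row_base K) row_sub.
  by rewrite KP => /andP [/eqP e1 /eqP e2]; rewrite (stab _ a) ?(stab _ b) ?eqxx.
have [c /eigenvalueP [r hc r0]] := eigenvalue_closed (B *m M^T *m pinvmx B) K0.
exists (r *m B)^T, c.
have : (r *m B <= K)%MS by rewrite -(eq_row_base K) submxMl.
rewrite KP => /andP [/eqP e1 /eqP e2]; split => //.
  rewrite trmx_eq0; apply: contra r0 => /eqP rB.
  by rewrite -(mulmx_free_eq0 r (row_base_free K)) rB.
apply: trmx_inj; rewrite trmx_mul trmxK linearZ /= trmxK scalemxAl -hc.
by rewrite -(mulmxA r (B *m M^T *m pinvmx B) B) mulmxKpV // mulmxA.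
Qed.

(** A nonpositive vector orthogonal to both would be collinear with both. *)
Lemma plane_normal x y : x != 0 -> (forall c, y <> c *: x) ->
  h x x <= 0 -> h y y <= 0 ->
  exists n, [/\ h n n = 1, h n x = 0 & h n y = 0].
Proof.
move=> x0 xy hx hy.
have [||||n [c [n0 _ nx ny]]] := @orthogonal_eigenvector 1%:M x y 1 1.
- by rewrite /isometry trmx1 map_mx1 mul1mx mulmx1.
- exact: unitmx1.
- by rewrite mul1mx scale1r.
- by rewrite mul1mx scale1r.
have nn : 0 < h n n.
  have := hform_real n; rewrite realE => /orP [n_ge0|n_le0].
    rewrite lt_def n_ge0 andbT; apply/eqP => nn.
    have n_le0 : h n n <= 0 by rewrite nn.
    have [d xd] := nonpos_orth_colinear n0 n_le0 hx nx.
    have [e ye] := nonpos_orth_colinear n0 n_le0 hy ny.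
    apply: (xy (e / d)); rewrite xd ye scalerA divfK //.
    by apply: contraNneq x0 => d0; rewrite xd d0 scale0r.
  have [d xd] := nonpos_orth_colinear n0 n_le0 hx nx.
  have [e ye] := nonpos_orth_colinear n0 n_le0 hy ny.
  case: (xy (e / d)); rewrite xd ye scalerA divfK //.
  by apply: contraNneq x0 => d0; rewrite xd d0 scale0r.
exists ((sqrtC (h n n))^-1 *: n); rewrite !hformE nx ny !mulr0; split => //.
have s0 : 0 < sqrtC (h n n) by rewrite sqrtC_gt0.
rewrite geC0_conj ?invr_ge0 ?ltW // mulrA -invfM -expr2 sqrtCK mulVf //.
by rewrite gt_eqF.
Qed.

Definition frame x y z : 'M[C]_3 :=
  \matrix_(i < 3, j < 3) [:: x i 0; y i 0; z i 0]`_j.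

Lemma frame_mul x y n (u : 'cV[C]_3) :
  frame x y n *m u = u 0 0 *: x + u 1 0 *: y + u 2 0 *: n.
Proof.
apply/colP => i; rewrite !mxE !big_ord_recl big_ord0 !mxE /=.
have -> : lift 0 0 = 1 :> 'I_3 by apply: val_inj.
have -> : lift 0 (lift 0 0) = 2 :> 'I_3 by apply: val_inj.
ring.
Qed.

Lemma mul_frame M x y n : M *m frame x y n = frame (M *m x) (M *m y) (M *m n).
Proof.
apply/matrixP => i j; rewrite !mxE.
by case: j => [[|[|[|//]]] jlt] /=; apply: eq_bigr => k _; rewrite !mxE.
Qed.

Lemma frame_unit x y n : x != 0 -> (forall c, y <> c *: x) ->
  h n n != 0 -> h n x = 0 -> h n y = 0 -> frame x y n \in unitmx.
Proof.
move=> x0 xy nn nx ny.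
rewrite -unitmx_tr -row_free_unit -kermx_eq0; apply/rowV0P => r.
rewrite sub_kermx -trmx_eq0 trmx_mul trmxK frame_mul.
set a := _ 0 0; set b := _ 1 0; set c := _ 2 0 => /eqP e0.
have c0 : c = 0.
  have := congr1 (h ^~ n) e0.
  rewrite !hformE hform0l (hformC x) (hformC y) nx ny conjC0 !mulr0 !add0r.
  by move/eqP; rewrite mulf_eq0 (negPf nn) orbF => /eqP.
have b0 : b = 0.
  apply/eqP/negPn/negP => b0; apply: (xy (- (a / b))).
  apply: (scalerI b0); rewrite scalerA mulrN mulrC divfK //.
  move/eqP: e0; rewrite c0 scale0r addr0 addrC addr_eq0 => /eqP ->.
  by rewrite scaleNr.
have a0 : a = 0.
  move/eqP: e0; rewrite c0 b0 !scale0r !addr0 scaler_eq0 (negPf x0) orbF.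
  by move/eqP.
apply/rowP => i; rewrite mxE; case: i => [[|[|[|//]]] ilt].
- by rewrite -[RHS]a0 /a mxE; congr (r _ _); apply: val_inj.
- by rewrite -[RHS]b0 /b mxE; congr (r _ _); apply: val_inj.
- by rewrite -[RHS]c0 /c mxE; congr (r _ _); apply: val_inj.
Qed.

Lemma form_nondegenerate P w : P \in unitmx ->
  (forall i, h w (col i P) = 0) -> w = 0.
Proof.
move=> uP wP.
have PJw : P^T^c *m J *m w = 0.
  apply/colP => i; rewrite [RHS]mxE -[RHS](wP i) /hform -!mulmxA.
  by rewrite tr_col map_row -row_mul [RHS]mxE mulmxA.
have uJ := form_unitmx; have uP' : P^T^c \in unitmx by rewrite conjmx_unit unitmx_tr.
by rewrite -(mulKmx uJ w) -(mulKmx uP' (J *m w)) (mulmxA P^T^c) PJw !mulmx0.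
Qed.

Lemma frame_inj x y z x' y' z' :
  frame x y z = frame x' y' z' -> [/\ x = x', y = y' & z = z'].
Proof.
move/matrixP => e; split; apply/colP => i.
- by have := e i 0; rewrite !mxE.
- by have := e i 1; rewrite !mxE.
- by have := e i 2; rewrite !mxE.
Qed.

Lemma col_frame x y z i : col i (frame x y z) = [:: x; y; z]`_i.
Proof.
by apply/colP => k; rewrite !mxE; case: i => [[|[|[|//]]] ilt].
Qed.

Lemma frame_nondegenerate x y n w : frame x y n \in unitmx ->
  h w x = 0 -> h w y = 0 -> h w n = 0 -> w = 0.
Proof.
move=> uF wx wy wn; apply: (form_nondegenerate uF) => i; rewrite col_frame.
by elim/ord3_ind: i; [exact: wx | exact: wy | exact: wn].
Qed.

Lemma antiunitaryP F M : F \in unitmx ->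
  (forall i j, h (anti M (col i F)) (anti M (col j F)) =
     (h (col i F) (col j F))^*) -> antiunitary M.
Proof.
move=> uF hF; have uFc : F^c \in unitmx by rewrite conjmx_unit.
suff e : F^T *m (M^T^c *m J *m M) *m F^c = F^T *m J^c *m F^c.
  have uFt : F^T \in unitmx by rewrite unitmx_tr.
  rewrite /antiunitary -[LHS](mulKmx uFt) -[X in _ *m X](mulmxK uFc) e.
  by rewrite (mulmxK uFc) mulKmx.
apply/matrixP => i j; move/eqP: (hF j i); rewrite /hform /anti => /eqP.
have -> (A : 'M[C]_1) : (A 0 0)^* = A^c 0 0 by rewrite !mxE.
have e1 (A : 'M[C]_3) : (F^T *m A *m F^c) i j =
    ((col i F)^T *m A *m (col j F)^c) 0 0.
  by rewrite tr_col -row_mul !mxE; apply: eq_bigr => k _; rewrite !mxE.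
by rewrite !e1 !trmx_mul !conjmx_mul !map_trmx !conjmxK !mulmxA => ->.
Qed.

End Signature.
End HermitianForm.

(** * Antiunitary maps *)

Section Antiunitary.
Variables (R : realType) (J : 'M[Cplx R]_3).
Hypothesis hJ : signature21 J.
Local Notation C := (Cplx R).
Local Notation h := (hform J).
Local Notation "M ^c" := (map_mx Num.conj M).
Implicit Types (a b c : C) (x y z : 'cV[C]_3) (M N : 'M[C]_3).

(** An eigenvector orthogonal to two orthogonal positive eigenvectors is
    nonpositive, since three pairwise orthogonal positive vectors would make
    the form positive definite. *)
Lemma nonpos_eigenvector M : isometry J M -> M \in unitmx ->
  exists u c, [/\ u != 0, M *m u = c *: u & h u u <= 0].
Proof.
move=> hM uM.
have nonposP u : ~~ (h u u <= 0) -> 0 < h u u.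
  by rewrite -real_ltNge // hform_real.
have Z0 : M *m 0 = 0 *: (0 : 'cV[C]_3) by rewrite mulmx0 scaler0.
have [u [a [u0 hu _ _]]] := orthogonal_eigenvector hM uM Z0 Z0.
case: (boolP (h u u <= 0)) => [?|/nonposP up]; first by exists u, a.
have [v [b [v0 hv vu _]]] := orthogonal_eigenvector hM uM hu Z0.
case: (boolP (h v v <= 0)) => [?|/nonposP vp]; first by exists v, b.
have [w [c [w0 hw wu wv]]] := orthogonal_eigenvector hM uM hu hv.
case: (boolP (h w w <= 0)) => [?|/nonposP wp]; first by exists w, c.
have [z hz] := negative_vector hJ.
have uF : frame u v w \in unitmx.
  apply: (frame_unit hJ) => //; last by rewrite gt_eqF.
  move=> d vd; move: vu v0; rewrite vd hformZl => /eqP.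
  by rewrite mulf_eq0 (gt_eqF up) orbF => /eqP ->; rewrite scale0r eqxx.
have uv : h u v = 0 by rewrite (hformC hJ) vu conjC0.
have uw : h u w = 0 by rewrite (hformC hJ) wu conjC0.
have vw : h v w = 0 by rewrite (hformC hJ) wv conjC0.
pose t := z - (h z u / h u u) *: u - (h z v / h v v) *: v
            - (h z w / h w w) *: w.
have t0 : t = 0.
  apply: (frame_nondegenerate hJ uF);
    rewrite !hformE ?vu ?wu ?uv ?wv ?uw ?vw !mulr0 ?oppr0 ?addr0 ?add0r.
  - by rewrite divfK ?gt_eqF // subrr.
  - by rewrite divfK ?gt_eqF // subrr.
  - by rewrite divfK ?gt_eqF // subrr.
have /eqP := congr1 (h ^~ z) t0; rewrite hform0l !hformE.
rewrite -!addrA -!opprD subr_eq0 => /eqP e.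
have pos y : 0 < h y y -> 0 <= h z y / h y y * h y z.
  by move=> hy; rewrite mulrAC (hformC hJ y z) divr_ge0 ?mul_conjC_ge0 ?ltW.
by move: hz; rewrite e le_gtF // !addr_ge0 // pos.
Qed.

(** Write [T] for the antilinear map.  By antiunitarity the eigenvalue [c] of
    [T^2] at a nonpositive [v] satisfies [c * h v (T v) = h v (T v)], so it
    is 1 unless [v] and [T v] are orthogonal; they are then collinear, say
    [T v = d *: v], and [c = `|d| ^+ 2]. *)
Lemma antiunitary_pos_eigenvector M : antiunitary J M ->
  exists v c, [/\ v != 0, h v v <= 0, M *m M^c *m v = c *: v & 0 < c].
Proof.
move=> hM; have iN := antiunitary_mul_conj hM hM.
have uM := antiunitary_unit hJ hM.
have uN : M *m M^c \in unitmx by rewrite unitmx_mul uM conjmx_unit.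
have [v [c [v0 hv vv]]] := nonpos_eigenvector iN uN.
exists v, c; split => //.
have := hform_antiunitary v (anti M v) hM.
rewrite anti_anti hv hformZr (hformC hJ (anti M v) v) -rmorphM /=.
move/(can_inj conjCK).
case: (eqVneq (h v (anti M v)) 0) => [q0 _|q0]; last first.
  move/(canRL (mulfK q0)) ->.
  by rewrite mulfV // ltr01.
have TT : h (anti M v) (anti M v) <= 0 by rewrite hform_antiunitary -?(hformC hJ).
have [d Tv] := nonpos_orth_colinear hJ v0 vv TT q0.
have d0 : d != 0.
  apply: contra_neq v0 => d0.
  have := anti_anti M M v; rewrite Tv d0 scale0r /anti map_mx0 mulmx0 => /esym.
  by move/(congr1 (mulmx (invmx (M *m M^c)))); rewrite mulKmx // mulmx0.
have : c *: v = (d * d^*) *: v by rewrite -hv -anti_anti Tv antiZ Tv scalerA mulrC.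
move/eqP; rewrite -subr_eq0 -scalerBl scaler_eq0 (negPf v0) orbF subr_eq0.
by move/eqP ->; rewrite lt_def mul_conjC_ge0 mul_conjC_eq0 d0.
Qed.

(** The square of an antiunitary map is an isometry of determinant 1, so its
    remaining eigenvalue, on the normal of the plane, is 1 as well. *)
Lemma antiunitary_involution M x y : antiunitary J M ->
  x != 0 -> (forall c, y <> c *: x) -> h x x <= 0 -> h y y <= 0 ->
  anti M (anti M x) = x -> anti M (anti M y) = y -> M *m M^c = 1%:M.
Proof.
move=> hM x0 xy xx yy; rewrite !anti_anti => Nx Ny.
have iN := antiunitary_mul_conj hM hM.
have dN := antiunitary_det hJ hM.
set N := M *m _ in Nx Ny iN dN *.
have [n [nn nx ny]] := plane_normal hJ x0 xy xx yy.
have uF : frame x y n \in unitmx.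
  by apply: (frame_unit hJ) => //; rewrite nn oner_neq0.
have Nn : N *m n = h (N *m n) n *: n.
  apply/eqP; rewrite -subr_eq0; apply/eqP/(frame_nondegenerate hJ uF).
  - by rewrite !hformE nx mulr0 subr0 -Nx hform_isometry.
  - by rewrite !hformE ny mulr0 subr0 -Ny hform_isometry.
  - by rewrite !hformE nn mulr1 subrr.
have NF := mul_frame N x y n; rewrite Nx Ny Nn in NF.
set r := h _ _ in NF.
have Fr : frame x y (r *: n) = frame x y n *m diag_mx (\row_j [:: 1; 1; r]`_j).
  apply/matrixP => i j; rewrite mul_mx_diag !mxE.
  by case: j => [[|[|[|//]]] jlt] /=; rewrite ?mulr1 ?mxE // mulrC.
have r1 : r = 1.
  have := congr1 determinant NF; rewrite Fr [LHS]det_mulmx [RHS]det_mulmx dN mul1r det_diag.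
  rewrite !big_ord_recl big_ord0 !mxE /= !mul1r mulr1 => /esym/eqP.
  have dF : \det (frame x y n) != 0 by rewrite -unitfE -unitmxE.
  by rewrite -subr_eq0 -{2}[\det _]mulr1 -mulrBr mulf_eq0 (negPf dF) subr_eq0 => /eqP.
by rewrite -(mulmxK uF N) NF r1 scale1r mulmxV.
Qed.
End Antiunitary.

(** * Extension of antiunitary maps *)

Section Extension.
Variables (R : realType) (J : 'M[Cplx R]_3).
Hypothesis hJ : signature21 J.
Local Notation C := (Cplx R).
Local Notation h := (hform J).
Local Notation "M ^c" := (map_mx Num.conj M).
Implicit Types (a b c : C) (x y z : 'cV[C]_3) (M N : 'M[C]_3).

Lemma antiunitary_frame (x y : 'I_3 -> 'cV[C]_3) :
  frame (x 0) (x 1) (x 2) \in unitmx ->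
  (forall i j, h (y i) (y j) = (h (x i) (x j))^*) ->
  exists2 M, antiunitary J M & forall i, anti M (x i) = y i.
Proof.
set F := frame _ _ _ => uF gram.
pose M := frame (y 0) (y 1) (y 2) *m invmx F^c.
have MF : M *m F^c = frame (y 0) (y 1) (y 2).
  by rewrite mulmxKV // conjmx_unit.
have Fc : F^c = frame (x 0)^c (x 1)^c (x 2)^c.
  apply/matrixP => i j; rewrite !mxE.
  by case: j => [[|[|[|//]]] jlt] /=; rewrite ?mxE.
have Mx i : anti M (x i) = y i.
  have [e0 e1 e2] : [/\ anti M (x 0) = y 0, anti M (x 1) = y 1 &
                        anti M (x 2) = y 2].
    by apply: frame_inj; rewrite -MF Fc mul_frame.
  by case: i => [[|[|[|//]]] ilt];
    [rewrite (_ : Ordinal _ = 0) | rewrite (_ : Ordinal _ = 1) |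
     rewrite (_ : Ordinal _ = 2)] => //; apply: val_inj.
exists M => //; apply: (antiunitaryP uF) => i j.
have colF k : col k F = x k.
  rewrite col_frame; case: k => [[|[|[|//]]] klt] /=; congr x; exact: val_inj.
by rewrite !colF !Mx gram.
Qed.

(** Inner products with the vectors of the plane are conjugate already; the
    phase [mu] of the image of the normal [n] is free, and is used to match
    the remaining coordinates [h (X i) n] and [h (Y i) n'], whose Gram
    matrices are conjugate. *)
Lemma antiunitary_extension (I : Type) (X Y : I -> 'cV[C]_3) (i1 i2 : I) :
  X i1 != 0 -> (forall c, X i2 <> c *: X i1) ->
  h (X i1) (X i1) <= 0 -> h (X i2) (X i2) <= 0 ->
  (forall i j, h (Y i) (Y j) = (h (X i) (X j))^*) ->
  exists2 M, antiunitary J M & forall i, anti M (X i) = Y i.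
Proof.
move=> x0 x12 hx1 hx2 gram.
have gramC i j : h (X i) (X j) = (h (Y i) (Y j))^* by rewrite gram conjCK.
have y0 : Y i1 != 0.
  apply/eqP => y0.
  have [|c] := nonpos_orth_colinear hJ x0 hx1 hx2; last exact: x12.
  by rewrite gramC y0 hform0l conjC0.
have y12 c : Y i2 <> c *: Y i1.
  move=> y12; pose w := X i2 - c^* *: X i1.
  have hw i : h w (X i) = 0.
    by rewrite !hformE !gramC -rmorphM -rmorphB /= y12 hformZl subrr conjC0.
  have ww : h w w = 0 by rewrite {2}/w hformDr hformNr hformZr !hw mulr0 subrr.
  have ww0 : h w w <= 0 by rewrite ww.
  have [|d wd] := nonpos_orth_colinear hJ x0 hx1 ww0.
    by rewrite (hformC hJ) hw conjC0.
  by apply: (x12 (d + c^*)); rewrite scalerDl -wd subrK.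
have hy1 : h (Y i1) (Y i1) <= 0 by rewrite gram -(hformC hJ).
have hy2 : h (Y i2) (Y i2) <= 0 by rewrite gram -(hformC hJ).
have [n [nn nx1 nx2]] := plane_normal hJ x0 x12 hx1 hx2.
have [n' [nn' ny1 ny2]] := plane_normal hJ y0 y12 hy1 hy2.
have x1n : h (X i1) n = 0 by rewrite (hformC hJ) nx1 conjC0.
have x2n : h (X i2) n = 0 by rewrite (hformC hJ) nx2 conjC0.
have y1n : h (Y i1) n' = 0 by rewrite (hformC hJ) ny1 conjC0.
have y2n : h (Y i2) n' = 0 by rewrite (hformC hJ) ny2 conjC0.
have uX : frame (X i1) (X i2) n \in unitmx.
  by apply: (frame_unit hJ) => //; rewrite nn oner_neq0.
have uY : frame (Y i1) (Y i2) n' \in unitmx.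
  by apply: (frame_unit hJ) => //; rewrite nn' oner_neq0.
have ext mu : mu * mu^* = 1 -> exists2 M, antiunitary J M &
    [/\ anti M (X i1) = Y i1, anti M (X i2) = Y i2 & anti M n = mu *: n'].
  move=> mu1.
  have [|i j|M hM Mx] := @antiunitary_frame
    (fun i => nth 0 [:: X i1; X i2; n] i)
    (fun i => nth 0 [:: Y i1; Y i2; mu *: n'] i); first exact: uX.
    by case: i => [[|[|[|//]]] ilt] /=; case: j => [[|[|[|//]]] jlt] /=;
      rewrite ?hformZl ?hformZr ?gram ?nx1 ?nx2 ?x1n ?x2n ?ny1 ?ny2 ?y1n ?y2n
              ?nn ?nn' ?conjC0 ?conjC1 ?mulr0 // mulr1 -mu1.
  by exists M => //; split; [exact: (Mx 0) | exact: (Mx 1) | exact: (Mx 2)].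
pose p i := h (X i) n; pose q i := h (Y i) n'.
have match_coord M mu : antiunitary J M -> mu * mu^* = 1 ->
    anti M (X i1) = Y i1 -> anti M (X i2) = Y i2 -> anti M n = mu *: n' ->
    forall i, Y i = anti M (X i) + (q i - mu * (p i)^*) *: n'.
  move=> hM mu1 M1 M2 Mn i; apply/eqP; rewrite -subr_eq0; apply/eqP.
  have Man : h (anti M (X i)) n' = mu * (p i)^*.
    rewrite /p -(hform_antiunitary (X i) n hM) Mn hformZr mulrA mu1.
    by rewrite mul1r.
  apply: (frame_nondegenerate hJ uY); rewrite !hformE ?ny1 ?ny2 ?nn' ?Man.
  - by rewrite -{2}M1 hform_antiunitary // -gram; form_ring.
  - by rewrite -{2}M2 hform_antiunitary // -gram; form_ring.
  - by rewrite /q; form_ring.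
have coord_gram i j : q i * (q j)^* = (p i)^* * p j.
  have [|M hM [M1 M2 Mn]] := ext 1; first by rewrite conjC1 mulr1.
  have d1 : 1 * 1^* = 1 :> C by rewrite conjC1 mulr1.
  have e := match_coord M 1 hM d1 M1 M2 Mn.
  have := gram i j; rewrite [in X in X = _](e i) [in X in X = _](e j) !hformE.
  have an k : h (anti M (X k)) n' = (p k)^*.
    by rewrite /p -(hform_antiunitary (X k) n hM) Mn scale1r.
  have na k : h n' (anti M (X k)) = p k by rewrite (hformC hJ) an conjCK.
  rewrite an na nn' hform_antiunitary // !rmorphB !rmorphM /= !conjCK conjC1.
  move=> /eqP; rewrite -subr_eq0 => /eqP g; apply/eqP; rewrite -subr_eq0.
  by apply/eqP; rewrite -[RHS]g; form_ring.
have [mu mu1 qp] : exists2 mu, mu * mu^* = 1 & forall i, q i = mu * (p i)^*.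
  case: (pselect (exists i, p i != 0)) => [[i0 p0]|np]; last first.
    exists 1 => [|i]; first by rewrite conjC1 mulr1.
    have pi0 : p i = 0 by apply: contrapT => /eqP pi0; apply: np; exists i.
    apply/eqP; rewrite pi0 conjC0 mulr0 -mul_conjC_eq0 coord_gram pi0.
    by rewrite mulr0.
  have pc0 : (p i0)^* != 0 by rewrite conjC_eq0.
  have q0 : (q i0)^* != 0.
    have : q i0 * (q i0)^* != 0 by rewrite coord_gram mulf_neq0.
    by apply: contraNneq => ->; rewrite mulr0.
  exists (q i0 / (p i0)^*) => [|i].
    rewrite rmorphM /= fmorphV /= conjCK mulf_div coord_gram mulfV //.
    by rewrite mulf_neq0.
  apply: (mulIf q0); rewrite coord_gram.
  transitivity (q i0 * (q i0)^* * (p i)^* / (p i0)^*); last by ring.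
  by rewrite coord_gram mulrAC [(p i0)^* * p i0]mulrC mulfK // mulrC.
have [M hM [M1 M2 Mn]] := ext mu mu1; exists M => // i.
by rewrite [RHS](match_coord M mu) // qp subrr scale0r addr0.
Qed.
End Extension.

(** * Points of the complex hyperbolic plane *)

Section Points.
Variables (R : realType) (J : 'M[Cplx R]_3).
Hypothesis hJ : signature21 J.
Local Notation C := (Cplx R).
Local Notation h := (hform J).
Local Notation "M ^c" := (map_mx Num.conj M).
Implicit Types (a b c : C) (x y z : 'cV[C]_3) (M N : 'M[C]_3).

Lemma dim_span1 x : x != 0 -> \dim <[x]>%VS == 1%N.
Proof. by move=> x0; rewrite dim_vline x0. Qed.

Definition point x (x0 : x != 0) : CP2 R := MkCP2 (dim_span1 x0).

Lemma CP2_eq (p q : CP2 R) : line p = line q -> p = q.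
Proof. exact: val_inj. Qed.

Lemma CP2_span (p : CP2 R) : vpick p != 0 /\ line p = <[vpick p]>%VS.
Proof.
have p0 : vpick p != 0 by rewrite vpick0 -dimv_eq0 (eqP (dim_line p)).
split=> //; apply/esym/eqP; rewrite eqEdim -memvE memv_pick.
by rewrite (eqP (dim_line p)) dim_vline p0.
Qed.

Lemma span_eq x y : x != 0 -> <[x]>%VS = <[y]>%VS ->
  exists2 c, c != 0 & x = c *: y.
Proof.
move=> x0 e; have : x \in <[y]>%VS by rewrite -e memv_line.
move=> /vlineP [c xc]; exists c => //.
by apply: contraNneq x0 => c0; rewrite xc c0 scale0r.
Qed.

Lemma span_scale c x : c != 0 -> <[c *: x]>%VS = <[x]>%VS.
Proof.
move=> c0; apply/eqP; rewrite eqEsubv -!memvE memvZ ?memv_line //=.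
by rewrite -[X in X \in _](scalerK c0) memvZ // memv_line.
Qed.

Lemma neg_neq0 x : h x x < 0 -> x != 0.
Proof. by apply: contraTneq => ->; rewrite hform0l ltxx. Qed.

Lemma hform_scale_neg c x : c != 0 -> (h (c *: x) (c *: x) < 0) = (h x x < 0).
Proof.
move=> c0; rewrite !hformE mulrA pmulr_rlt0 // lt_def mul_conjC_ge0.
by rewrite mul_conjC_eq0 c0.
Qed.

Lemma H2_span_neg (p : H2 J) z : line (\val p) = <[z]>%VS -> h z z < 0.
Proof.
have /set_mem [w wneg pw] := valP p; rewrite pw.
by move/(span_eq (neg_neq0 wneg)) => [c c0 wc]; move: wneg; rewrite wc hform_scale_neg.
Qed.

Lemma H2_pick_neg (p : H2 J) : h (vpick (\val p)) (vpick (\val p)) < 0.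
Proof. by apply: (@H2_span_neg p); have [] := CP2_span (\val p). Qed.

Lemma H2_point z : h z z < 0 -> exists p : H2 J, line (\val p) = <[z]>%VS.
Proof.
move=> zneg; have hp : H2 J (point (neg_neq0 zneg)) by exists z.
by exists (SigSub (mem_set hp)).
Qed.

Lemma H2_eq (p q : H2 J) : line (\val p) = line (\val q) -> p = q.
Proof. by move=> e; apply: val_inj; apply: CP2_eq. Qed.

Lemma clH2_span p : clH2 J p <->
  exists z, [/\ z != 0, h z z <= 0 & line p = <[z]>%VS].
Proof.
split.
  case=> [[z zneg pz]|[z [z0 zz] pz]]; exists z; split => //.
  - exact: neg_neq0 zneg.
  - exact: ltW.
  - by rewrite zz.
case=> z [z0]; rewrite le_eqVlt => /orP [/eqP zz|zneg] pz.
  by right; exists z.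
by left; exists z.
Qed.

(** ** Distances *)

(** The squared hyperbolic cosine of half the distance, as a complex number. *)
Definition ratio x y : C := h x y * (h x y)^* / (h x x * h y y).

Lemma ratio_real x y : ratio x y \is Num.real.
Proof.
apply: realM; first by rewrite ger0_real ?mul_conjC_ge0.
by rewrite realV realM // (hform_real hJ).
Qed.

Lemma cosh2_half_ratioE x y : cosh2_half_ratio J x y = complex.Re (ratio x y).
Proof. by rewrite /cosh2_half_ratio normCK. Qed.

Lemma ratio_scale a b x y : a != 0 -> b != 0 ->
  ratio (a *: x) (b *: y) = ratio x y.
Proof.
move=> a0 b0; rewrite /ratio !hformE !rmorphM /= !conjCK.
have ac0 : a^* != 0 by rewrite conjC_eq0.
have bc0 : b^* != 0 by rewrite conjC_eq0.
have -> : a * (b^* * h x y) * (a^* * (b * (h x y)^*)) =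
  (a * a^* * (b * b^*)) * (h x y * (h x y)^*) by form_ring.
have -> : a * (a^* * h x x) * (b * (b^* * h y y)) =
  (a * a^* * (b * b^*)) * (h x x * h y y) by form_ring.
by rewrite -mulf_div divff ?mul1r // !mulf_neq0.
Qed.

(** Reversed Cauchy-Schwarz inequality: the part of [y] orthogonal to [x] is
    nonnegative. *)
Lemma ratio_ge1 x y : h x x < 0 -> h y y < 0 -> 1 <= ratio x y.
Proof.
move=> xneg yneg; rewrite /ratio.
have xy0 : 0 < h x x * h y y by rewrite nmulr_lgt0.
rewrite ler_pdivlMr // mul1r.
pose w := y - (h y x / h x x) *: x.
have x0 : h x x != 0 by rewrite lt_eqF.
have wx : h w x = 0 by rewrite !hformE divfK // subrr.
have ww : 0 <= h w w.
  have [->|w0] := eqVneq w 0; first by rewrite hform0l.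
  by apply/ltW/(orth_neg_pos hJ xneg).
have e : h w w = h y y - h x y * (h x y)^* / h x x.
  rewrite {2}/w hformDr hformNr hformZr wx mulr0 subr0 !hformE.
  by rewrite (hformC hJ y x); congr (_ - _); form_ring.
move: ww; rewrite e subr_ge0 ler_ndivrMr //.
by rewrite [h y y * _]mulrC.
Qed.

(** The distance is an injective function of [ratio], because [ratio] is real
    and at least 1. *)
Lemma dist_eq (p q p' q' : H2 J) x y x' y' :
  line (\val p) = <[x]>%VS -> line (\val q) = <[y]>%VS ->
  line (\val p') = <[x']>%VS -> line (\val q') = <[y']>%VS ->
  dist p q = dist p' q' <-> ratio x y = ratio x' y'.
Proof.
have distE (u v : H2 J) s t : line (\val u) = <[s]>%VS ->
    line (\val v) = <[t]>%VS ->
    dist u v = 2 * arccosh (Num.sqrt (complex.Re (ratio s t))).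
  move=> us vt; rewrite /dist cosh2_half_ratioE.
  have [u0 e] := CP2_span (\val u); have [v0 f] := CP2_span (\val v).
  have [a a0 ->] := span_eq u0 (etrans (esym e) us).
  have [b b0 ->] := span_eq v0 (etrans (esym f) vt).
  by rewrite ratio_scale.
move=> px qy px' qy'; rewrite (distE _ _ _ _ px qy) (distE _ _ _ _ px' qy').
split=> [|->//] /(mulfI _) e.
have Re1 s t : h s s < 0 -> h t t < 0 -> 1 <= complex.Re (ratio s t).
  move=> sneg tneg; have := ratio_ge1 sneg tneg.
  by rewrite -[ratio s t]RRe_real ?ratio_real // (lecR 1).
have {}e := e (lt0r_neq0 (ltr0Sn _ _)).
have r1 := Re1 _ _ (H2_span_neg px) (H2_span_neg qy).
have r2 := Re1 _ _ (H2_span_neg px') (H2_span_neg qy').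
have s1 r : 1 <= r -> 1 <= Num.sqrt r :> R by move=> r1'; rewrite -sqrtr1 ler_wsqrtr.
have := congr1 (@cosh R) e; rewrite !arccoshK ?s1 // => /eqP.
rewrite eqr_sqrt ?(le_trans ler01) // => /eqP ee.
by rewrite -[LHS]RRe_real ?ratio_real // ee RRe_real ?ratio_real.
Qed.
End Points.

(** * Real reflections and antiunitary involutions *)

Section Reflections.
Variables (R : realType) (J : 'M[Cplx R]_3).
Hypothesis hJ : signature21 J.
Local Notation C := (Cplx R).
Local Notation h := (hform J).
Local Notation "M ^c" := (map_mx Num.conj M).
Implicit Types (a b c : C) (x y z : 'cV[C]_3) (M N P : 'M[C]_3).
Implicit Type s : H2 J -> H2 J.

Definition anti_lift s M : Prop := forall (p : H2 J) z,
  line (\val p) = <[z]>%VS -> line (\val (s p)) = <[anti M z]>%VS.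

Lemma RtoC_conj (r : R) : (RtoC r)^* = RtoC r.
Proof. by apply/CrealP/complex_realP; exists r. Qed.

Lemma RtoC_Re c : c^* = c -> RtoC (complex.Re c) = c.
Proof. by move=> /CrealP; exact: RRe_real. Qed.

Lemma RtoC_inj : injective (@RtoC R).
Proof. by move=> r s []. Qed.

Lemma real_combination P (a : 'I_3 -> R) :
  \sum_i RtoC (a i) *: col i P = P *m \col_i RtoC (a i).
Proof.
apply/colP => k; rewrite summxE mxE; apply: eq_bigr => i _.
by rewrite !mxE mulrC.
Qed.

(** Averaging [th] over the antilinear involution, as in Hilbert's theorem
    90: [P = th%:M + th^* *: M] always satisfies the equation, and it is
    invertible unless [- th / th^*] is an eigenvalue of [M]. *)
Lemma antilinear_involution_split M : M *m M^c = 1%:M ->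
  exists2 P, P \in unitmx & M *m P^c = P.
Proof.
move=> MM.
pose th (t : nat) : C := 1 + t%:R * 'i.
have thc t : (th t)^* = 1 - t%:R * 'i.
  by rewrite /th rmorphD rmorphM /= conjC1 conjC_nat conjCi mulrN.
have th0 t : th t != 0.
  apply/eqP => e; have := congr1 (fun a => a + a^*) e.
  rewrite thc /th conjC0 addr0 addrACA subrr addr0 => /eqP.
  by rewrite -mulr2n pnatr_eq0.
have thc0 t : (th t)^* != 0 by rewrite conjC_eq0.
pose f t := - (th t / (th t)^*).
have f_inj : injective f.
  move=> s t /oppr_inj /eqP; rewrite eqr_div // !thc /th => /eqP e.
  have : 2 * 'i * (s%:R - t%:R) = 0 :> C.
    transitivity ((1 + s%:R * 'i) * (1 - t%:R * 'i) -
                   (1 + t%:R * 'i) * (1 - s%:R * 'i) : C); last first.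
      by rewrite e subrr.
    by ring.
  move=> /eqP; rewrite !mulf_eq0 (negPf (neq0Ci _)) orbF pnatr_eq0 /=.
  by rewrite subr_eq0 eqr_nat => /eqP.
have [t ft] : exists t, ~~ eigenvalue M (f t).
  apply: contrapT => all_eig.
  have := @max_poly_roots _ (char_poly M) [seq f t | t <- iota 0 4].
  rewrite size_char_poly size_map size_iota ltnn.
  have -> : char_poly M != 0 by rewrite monic_neq0 ?char_poly_monic.
  rewrite (map_inj_uniq f_inj) iota_uniq.
  suff -> : all (root (char_poly M)) [seq f t | t <- iota 0 4] by move/(_ isT isT isT).
  apply/allP => _ /mapP [t _ ->]; rewrite -eigenvalue_root_char.
  by apply: contrapT => /negP ft; apply: all_eig; exists t.
exists ((th t)%:M + (th t)^* *: M).
  rewrite -row_free_unit -kermx_eq0; apply/rowV0P => r.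
  rewrite sub_kermx mulmxDr mul_mx_scalar -scalemxAr addrC addr_eq0 => /eqP e.
  apply: contraNeq ft => r0; apply/eigenvalueP; exists r => //.
  apply: (scalerI (thc0 t)); rewrite e scalerA /f mulrN mulrC divfK //.
  by rewrite scaleNr.
by rewrite map_mxD map_scalar_mx map_mxZ /= conjCK mulmxDr mul_mx_scalar
  -scalemxAr MM scalemx1 addrC.
Qed.

Lemma real_span_fixed M P v : P \in unitmx -> M *m P^c = P ->
  (exists a : 'I_3 -> R, v = \sum_i RtoC (a i) *: col i P) <-> anti M v = v.
Proof.
move=> uP MP; have uPc : P^c \in unitmx by rewrite conjmx_unit.
split=> [[a ->]|Mv].
  rewrite real_combination /anti conjmx_mul mulmxA MP.
  by congr (_ *m _); apply/colP => i; rewrite !mxE RtoC_conj.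
exists (fun i => complex.Re ((invmx P *m v) i 0)).
rewrite real_combination -[LHS](mulKVmx uP); congr (_ *m _).
apply/colP => i; rewrite [RHS]mxE RtoC_Re //.
have -> (x : 'cV[C]_3) : (x i 0)^* = x^c i 0 by rewrite mxE.
rewrite conjmx_mul conjmx_invmx -[in RHS]Mv /anti -(mulKVmx uPc v^c).
by rewrite (mulmxA M) MP mulKmx // mulKmx.
Qed.

Lemma anti_lift_exists M : antiunitary J M -> exists s, anti_lift s M.
Proof.
move=> hM.
have [p|s hs] := @choice (H2 J) (H2 J)
  (fun p q => line (\val q) = <[anti M (vpick (\val p))]>%VS).
  apply: H2_point; rewrite hform_antiunitary // -(hformC hJ).
  exact: H2_pick_neg.
exists s => p z pz; rewrite hs; have [v0 pv] := CP2_span (\val p).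
have [c c0 ->] := span_eq v0 (etrans (esym pv) pz).
by rewrite antiZ span_scale // conjC_eq0.
Qed.

Lemma ratio_antiunitary M x y : antiunitary J M ->
  ratio J (anti M x) (anti M y) = ratio J x y.
Proof.
move=> hM; rewrite /ratio !hform_antiunitary // conjCK -!(hformC hJ).
by rewrite [h y x * _]mulrC.
Qed.

Lemma differentiable_mulmx M (x : 'cV[C]_3) :
  differentiable (fun y : 'cV[C]_3 => M *m y) x.
Proof.
have -> : (fun y : 'cV[C]_3 => M *m y) =
    \sum_(i < 3) (fun y : 'cV[C]_3 => y i 0 *: col i M).
  apply/funext => y; rewrite fct_sumE; apply/colP => k.
  by rewrite summxE mxE; apply: eq_bigr => i _; rewrite !mxE mulrC.
apply: differentiable_sum => i.
by apply: differentiableZl; exact: differentiable_coord.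
Qed.

(** The fixed lines of [anti M] are spanned by fixed vectors: if
    [anti M z = c *: z] then [`|c| = 1], and [sqrtC c *: z] is fixed.  The
    fixed vectors form a real form of the space. *)
Lemma anti_lift_real_reflection s M : antiunitary J M -> M *m M^c = 1%:M ->
  anti_lift s M -> real_reflection s.
Proof.
move=> hM MM sM; have TT z : anti M (anti M z) = z by rewrite anti_anti MM mul1mx.
split.
- move=> Z _; exists (anti M).
  apply: (@nearW _ (nbhs Z) _ (nbhs_filter Z)) => Y; split; last first.
    by move=> p; exact: sM.
  rewrite (_ : (fun X => _) = fun X => M^c *m X); first exact: differentiable_mulmx.
  by apply/funext => X; rewrite /anti conjmx_mul conjmxK.
- move=> p q; have [_ pz] := CP2_span (\val p); have [_ qz] := CP2_span (\val q).
  apply/(dist_eq hJ (sM _ _ pz) (sM _ _ qz) pz qz).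
  exact: ratio_antiunitary.
- move=> p; apply: H2_eq; have [_ pz] := CP2_span (\val p).
  by rewrite (sM _ _ (sM _ _ pz)) TT -pz.
have [P uP MP] := antilinear_involution_split MM.
pose W := [set v | exists a : 'I_3 -> R, v = \sum_i RtoC (a i) *: col i P].
have WP v : W v <-> anti M v = v by exact: real_span_fixed.
exists W; split.
- exists (fun i => col i P); split => // a.
  rewrite real_combination => /(congr1 (mulmx (invmx P))).
  rewrite mulKmx // mulmx0 => /colP a0 i; apply: RtoC_inj.
  by have := a0 i; rewrite !mxE.
- move=> v w /WP Mv /WP Mw.
  by apply/CrealP; rewrite -{2}Mv -{2}Mw hform_antiunitary.
- have [z zneg] := negative_vector hJ; pose q := h z (anti M z).
  have Tz : h (anti M z) (anti M z) = h z z.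
    by rewrite hform_antiunitary // -(hformC hJ).
  have Tzz : h (anti M z) z = q^* by rewrite (hformC hJ).
  have qr : q + q^* \is Num.real by apply/CrealP; rewrite rmorphD /= conjCK addrC.
  have zz : h z z + h z z < 0 by rewrite -[0]addr0 ltrD.
  (* One of the fixed vectors [z + anti M z] and ['i *: (z - anti M z)] is
     negative, since their norms add up to [4 * h z z]. *)
  case/orP: (qr) => [q0|q0].
    exists ('i *: (z - anti M z)).
      apply/WP; rewrite antiZ conjCi scaleNr -scalerN.
      by rewrite antiD antiN TT opprD opprK addrC.
    have -> : h ('i *: (z - anti M z)) ('i *: (z - anti M z)) =
        - 'i ^+ 2 * (h z z + h z z - (q + q^*)).
      by rewrite !hformE Tz Tzz -/q conjCi; form_ring.
    by rewrite sqrCi opprK mul1r -[0]addr0 ltr_leD // oppr_le0.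
  exists (z + anti M z).
    by apply/WP; rewrite antiD TT addrC.
  have -> : h (z + anti M z) (z + anti M z) = h z z + h z z + (q + q^*).
    by rewrite !hformE Tz Tzz -/q; form_ring.
  by rewrite -[0]addr0 ltr_leD.
- apply/seteqP; split => p /=; last first.
    by move=> [v /WP Mv pv]; apply: H2_eq; rewrite (sM _ _ pv) Mv pv.
  move=> sp; have [_ pz] := CP2_span (\val p); set z := vpick _ in pz.
  have := sM _ _ pz; rewrite sp pz.
  have Tz0 : anti M z != 0.
    by apply: (@neg_neq0 _ J); rewrite hform_antiunitary // -(hformC hJ) (H2_span_neg pz).
  move/esym/(span_eq Tz0) => [c c0 Tz].
  have cc : c * c^* = 1.
    have z0 := neg_neq0 (H2_span_neg pz).
    apply/eqP; rewrite -subr_eq0 -[_ == 0]orbF -(negPf z0) -scaler_eq0.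
    by rewrite scalerBl scale1r mulrC -scalerA -Tz -antiZ -Tz TT subrr.
  pose e := sqrtC c; have ec : e ^+ 2 = c by rewrite sqrtCK.
  have ee : e * e^* = 1.
    apply/eqP; rewrite -(@pexpr_eq1 _ _ 2) ?mul_conjC_ge0 //.
    by rewrite exprMn -rmorphXn ec cc.
  have e0 : e != 0 by rewrite sqrtC_eq0.
  exists (e *: z); last by rewrite span_scale.
  apply/WP; rewrite antiZ Tz scalerA -ec expr2 mulrA [e^* * e]mulrC ee.
  by rewrite mul1r.
Qed.
End Reflections.

Section Lifts.
Variables (R : realType) (J : 'M[Cplx R]_3).
Hypothesis hJ : signature21 J.
Local Notation C := (Cplx R).
Local Notation h := (hform J).
Local Notation "M ^c" := (map_mx Num.conj M).
Implicit Types (a b c : C) (x y z : 'cV[C]_3) (M N P : 'M[C]_3).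
Implicit Type s : H2 J -> H2 J.

(** Each [v j] is [u j] or its conjugate, and the mixed terms force the same
    choice for all [j]. *)
Lemma eq_or_conj (I : Type) (u v : I -> C) (i0 : I) : u i0 = 1 -> v i0 = 1 ->
  (forall j k, u j * (u k)^* + u k * (u j)^* = v j * (v k)^* + v k * (v j)^*) ->
  (forall j, v j = u j) \/ (forall j, v j = (u j)^*).
Proof.
move=> u1 v1 uv.
have dich j : v j = u j \/ v j = (u j)^*.
  have tr := uv j i0; rewrite u1 v1 conjC1 !mulr1 !mul1r in tr.
  have nm := uv j j.
  have : (v j - u j) * (v j - (u j)^*) *+ 2 = 0.
    have -> : (v j - u j) * (v j - (u j)^*) *+ 2 =
      v j * v j *+ 2 - v j * (u j + (u j)^*) *+ 2 +
      (u j * (u j)^* + u j * (u j)^*) by ring.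
    by rewrite tr nm; ring.
  move=> /eqP; rewrite mulrn_eq0 /= mulf_eq0 !subr_eq0.
  by case/orP => /eqP; [left | right].
case: (pselect (forall j, v j = u j)) => [|/existsNP [j vuj]]; first by left.
right=> k; have vj : v j = (u j)^* by case: (dich j).
case: (dich k) => // vk; rewrite vk.
have := uv j k; rewrite vj vk conjCK => e.
have : (u j - (u j)^*) * ((u k)^* - u k) = 0.
  transitivity (u j * (u k)^* + u k * (u j)^* - ((u j)^* * (u k)^* + u k * u j)).
    by ring.
  by rewrite e subrr.
move=> /eqP; rewrite mulf_eq0 !subr_eq0 => /orP [/eqP uj|/eqP -> //].
by case: vuj; rewrite vj -uj.
Qed.

Lemma proportional_or_conj (I : Type) (u v : I -> C) a b :
  a != 0 -> b != 0 ->
  (forall j k, a * (u j * (u k)^* + u k * (u j)^*) =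
               b * (v j * (v k)^* + v k * (v j)^*)) ->
  exists c, (forall j, v j = c * u j) \/ (forall j, v j = c * (u j)^*).
Proof.
move=> a0 b0 uv.
have sq j : a * (u j * (u j)^*) = b * (v j * (v j)^*).
  have e := uv j j; apply: (@mulfI _ 2); first by rewrite pnatr_eq0.
  transitivity (a * (u j * (u j)^* + u j * (u j)^*)); first by ring.
  by rewrite e; form_ring.
case: (pselect (exists j, u j != 0)) => [[i ui]|nu]; last first.
  exists 0; left=> j; rewrite mul0r.
  have uj : u j = 0 by apply: contrapT => /eqP uj; apply: nu; exists j.
  have /esym/eqP := sq j; rewrite uj mul0r mulr0 mulf_eq0 (negPf b0) /=.
  by rewrite mul_conjC_eq0 => /eqP.
have vi : v i != 0.
  have : b * (v i * (v i)^*) != 0 by rewrite -sq !mulf_neq0 ?conjC_eq0.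
  by apply: contraNneq => ->; rewrite mul0r mulr0.
have [uc vc] : (u i)^* != 0 /\ (v i)^* != 0 by rewrite !conjC_eq0.
have m0 : a * (u i * (u i)^*) != 0 by rewrite !mulf_neq0.
case: (@eq_or_conj I (fun j => u j / u i) (fun j => v j / v i) i) => [|||e|e].
- by rewrite divff.
- by rewrite divff.
- move=> j k; rewrite !rmorphM !fmorphV /=; apply: (mulfI m0).
  transitivity (a * (u j * (u k)^* + u k * (u j)^*)).
    by field; apply/andP.
  by rewrite uv sq; field; apply/andP.
- exists (v i / u i); left=> j; rewrite mulrAC -mulrA.
  by rewrite -e mulrC divfK.
- exists (v i / (u i)^*); right=> j; have := e j.
  rewrite rmorphM fmorphV /= => /(canRL (divfK vi)) ->.
  by ring.
Qed.

(** Negative vectors are stable under small real perturbations, so that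
    identities that hold for negative vectors extend to all vectors. *)
Lemma neg_perturbation x y : h x x < 0 ->
  exists e : C, [/\ 0 < e, h (x + e *: y) (x + e *: y) < 0 &
                    h (x - e *: y) (x - e *: y) < 0].
Proof.
move=> xneg; pose B := h x y + h y x; pose D := h y y.
have Br : B \is Num.real.
  by apply/CrealP; rewrite /B rmorphD /= -!(hformC hJ) addrC.
have Dr : D \is Num.real by apply: hform_real.
have m0 : 0 < - h x x by rewrite oppr_gt0.
pose S := - h x x + `|B| + `|D|.
have S0 : 0 < S by rewrite ltr_wpDr // ltr_wpDr.
pose e := - h x x / S.
have e0 : 0 < e by rewrite divr_gt0.
have eC : e^* = e by rewrite geC0_conj // ltW.
have key b : b <= `|B| -> b \is Num.real -> h x x + e * b + e ^+ 2 * D < 0.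
  move=> bB br.
  have e1 : e <= 1.
    rewrite ler_pdivrMr // mul1r /S -addrA lerDl addr_ge0 //.
  have le1 : e * b <= e * `|B| by rewrite ler_pM2l.
  have le2 : e ^+ 2 * D <= e * `|D|.
    apply: (@le_trans _ _ (e ^+ 2 * `|D|)).
      by rewrite ler_pM2l ?exprn_gt0 // real_ler_norm.
    by rewrite ler_wpM2r // expr2 -[leRHS]mulr1 ler_pM2l.
  have eS : e * S = - h x x by rewrite divfK // gt_eqF.
  have lt3 : e * `|B| + e * `|D| < - h x x.
    rewrite -eS /S -addrA [X in _ < X]mulrDr mulrDr ltrDr mulr_gt0 //.
  by rewrite -addrA -ltrBDl sub0r (le_lt_trans (lerD le1 le2)).
clearbody e; exists e; split => //.
  have -> : h (x + e *: y) (x + e *: y) = h x x + e * B + e ^+ 2 * D.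
    by rewrite !hformE eC /B /D; form_ring.
  by apply: key => //; rewrite real_ler_norm.
have -> : h (x - e *: y) (x - e *: y) = h x x + e * (- B) + e ^+ 2 * D.
  by rewrite !hformE eC /B /D; form_ring.
by apply: key; rewrite ?rpredN // -normrN real_ler_norm ?rpredN.
Qed.

(** Compare the eigenvalues at [z], [z + e *: x] and [z - e *: x], where [z] is
    negative and [e] is small. *)
Lemma scalar_of_neg_eigenvectors M :
  (forall z, h z z < 0 -> exists c, M *m z = c *: z) -> exists c, M = c%:M.
Proof.
move=> eig; have [z zneg] := negative_vector hJ.
have z0 := neg_neq0 zneg; have [k Mz] := eig z zneg; exists k.
have Mx x : M *m x = k *: x.
  have [e [e0 pneg mneg]] := neg_perturbation x zneg.
  have [k1 M1] := eig _ pneg; have [k2 M2] := eig _ mneg.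
  move: M1 M2; rewrite !mulmxDr mulmxN -!scalemxAr Mz => M1 M2.
  have ne0 : e != 0 by rewrite gt_eqF.
  have s : (k + k - (k1 + k2)) *: z = (e * (k1 - k2)) *: x.
    transitivity (k *: z + e *: (M *m x) + (k *: z - e *: (M *m x))
                  - (k1 + k2) *: z).
      by rewrite addrACA subrr addr0 scalerBl scalerDl.
    rewrite M1 M2 !scalerDr !scalerN !scalerA addrACA -scalerDl addrAC subrr add0r.
    by rewrite -scalerBl; congr (_ *: _); ring.
  have [k12|k12] := eqVneq k1 k2; last first.
    have d0 : e * (k1 - k2) != 0 by rewrite mulf_neq0 // subr_eq0.
    have -> : x = ((e * (k1 - k2))^-1 * (k + k - (k1 + k2))) *: z.
      by rewrite -scalerA s scalerA mulVf // scale1r.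
    by rewrite -scalemxAr Mz !scalerA mulrC.
  move/eqP: s; rewrite k12 subrr mulr0 scale0r scaler_eq0 (negPf z0) orbF.
  rewrite -!mulr2n -mulrnBl mulrn_eq0 /= subr_eq0 => /eqP kk.
  apply: (scalerI ne0); apply: (addrI (k *: z)); rewrite M1 k12 -kk.
  by rewrite scalerDr !scalerA mulrC.
apply/matrixP => i j; have /colP /(_ i) := Mx (delta_mx j 0).
by rewrite -colE !mxE andbT mulr_natr.
Qed.

(** A totally real subspace of real dimension 3 with a negative vector is a
    real form: if [x + 'i *: y = 0] with [x] and [y] in it, then [y] is
    orthogonal to the whole subspace, in particular null and orthogonal to a
    negative vector. *)
Lemma real_plane_frame (W : set 'cV[C]_3) : real_subspace3 W ->
  totally_real J W -> (exists2 v, W v & h v v < 0) ->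
  exists2 P, P \in unitmx &
    (forall v, W v <-> exists a : 'I_3 -> R, v = \sum_i RtoC (a i) *: col i P) /\
    (forall i, W (col i P)).
Proof.
move=> [w [w_free ->]] realW [v0 Wv0 v0neg].
pose P := \matrix_(k < 3, i < 3) w i k 0 : 'M[C]_3.
have Pcol i : col i P = w i by apply/matrixP => k j; rewrite !mxE ord1.
exists P; last first.
  split=> [v|i].
    by split=> [] [a ->]; exists a; apply: eq_bigr => i _; rewrite Pcol.
  exists (fun j => (j == i)%:R); rewrite (bigD1 i) //= eqxx.
  rewrite big1 => [|j /negPf ->].
    by rewrite addr0 Pcol /RtoC /= scale1r.
  by rewrite /RtoC scale0r.
rewrite -unitmx_tr -row_free_unit -kermx_eq0; apply/rowV0P => r.
rewrite sub_kermx -trmx_eq0 trmx_mul trmxK => /eqP Pr0.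
pose a i := complex.Re (r 0 i); pose b i := complex.Im (r 0 i).
pose x := \sum_i RtoC (a i) *: w i; pose y := \sum_i RtoC (b i) *: w i.
set V := [set v | _] in realW Wv0.
have Vx : V x by exists a.
have Vy : V y by exists b.
have rE i : r 0 i = RtoC (a i) + 'i * RtoC (b i) by exact: complexE.
have xy : x = - 'i *: y.
  apply/eqP; rewrite scaleNr -addr_eq0 -Pr0; apply/eqP.
  have e f : \sum_i RtoC (f i) *: w i = P *m \col_i RtoC (f i).
    by rewrite -real_combination; apply: eq_bigr => i _; rewrite Pcol.
  rewrite /x /y !e scalemxAr -mulmxDr; congr (_ *m _).
  by apply/colP => i; rewrite !mxE rE.
have y_orth t : V t -> h y t = 0.
  move=> Vt; have /CrealP := realW _ _ Vx Vt; have /CrealP yt := realW _ _ Vy Vt.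
  rewrite xy hformZl rmorphM /= rmorphN /= conjCi opprK yt => /eqP.
  rewrite mulNr -addr_eq0 -mulr2n mulrn_eq0 /= mulf_eq0 (negPf (neq0Ci _)).
  by move/eqP.
have y0 : y = 0.
  apply/eqP/negPn/negP => y0.
  have := orth_neg_pos hJ v0neg (y_orth _ Wv0) y0.
  by rewrite (y_orth _ Vy) ltxx.
have x0 : x = 0 by rewrite xy y0 scaler0.
apply/rowP => i; rewrite rE (w_free a x0) (w_free b y0) mxE.
by rewrite /RtoC mulr0 addr0.
Qed.

(** The distances from the line of [Z] to the points of the real plane
    determine, up to scaling, the real part of the product of [h Z (w i)] with
    the conjugate of [h Z (w j)], for a real basis [w] of the plane, hence
    they determine the family of all [h Z (w i)] up to a common factor and
    complex conjugation.  A real reflection thus sends the line of [Z] to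
    itself or to its mirror image; it sends it to itself only on the real
    plane, where the two agree. *)
Lemma real_reflection_lift s : real_reflection s ->
  exists M, [/\ antiunitary J M, M *m M^c = 1%:M & anti_lift s M].
Proof.
move=> [_ iso _ [W [W3 realW Wneg fixW]]].
have [P uP [WP WcolP]] := real_plane_frame W3 realW Wneg.
have uPc : P^c \in unitmx by rewrite conjmx_unit.
pose M := P *m invmx P^c.
have MP : M *m P^c = P by rewrite mulmxKV.
have WM v : W v <-> anti M v = v.
  by rewrite WP; exact: real_span_fixed.
have hM : antiunitary J M.
  apply: (antiunitaryP uP) => i j.
  have /WM -> := WcolP i; have /WM -> := WcolP j.
  by apply/esym/CrealP/realW.
have MM : M *m M^c = 1%:M.
  apply: (can_inj (mulmxK uP)); rewrite mul1mx -mulmxA.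
  by rewrite -[X in M^c *m X]conjmxK -conjmx_mul MP.
exists M; split=> // p Z pZ; have Zneg := H2_span_neg pZ.
have Z0 := neg_neq0 Zneg.
have [Y0 spY] := CP2_span (\val (s p)); set Y := vpick _ in Y0 spY.
clearbody Y M.
have Yneg := H2_span_neg spY.
pose Q l := h Z Z * (h Y l * (h Y l)^*) - h Y Y * (h Z l * (h Z l)^*).
have Qneg l : W l -> h l l < 0 -> Q l = 0.
  move=> Wl lneg; have [q ql] := H2_point lneg.
  have sq : s q = q.
    by have : [set p | s p = p] q by rewrite fixW; exists l.
  have /(dist_eq hJ spY ql pZ ql) : dist (s p) q = dist p q.
    by rewrite -{1}sq iso.
  have nl := negbT (lt_eqF lneg).
  have nY := negbT (lt_eqF Yneg); have nZ := negbT (lt_eqF Zneg).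
  rewrite /ratio => /eqP; rewrite eqr_div ?mulf_neq0 // => /eqP e.
  apply: (mulIf nl); rewrite mul0r /Q mulrBl.
  apply/eqP; rewrite subr_eq0; apply/eqP.
  transitivity (h Y l * (h Y l)^* * (h Z Z * h l l)); first by form_ring.
  by rewrite e; form_ring.
have [v0 Wv0 v0neg] := Wneg.
have WD v w : W v -> W w -> W (v + w).
  by move=> /WM e /WM f; apply/WM; rewrite antiD e f.
have WZ c v : c^* = c -> W v -> W (c *: v).
  by move=> cr /WM e; apply/WM; rewrite antiZ e cr.
have Q0 w : W w -> Q w = 0.
  move=> Ww; have [e [e0 pneg mneg]] := neg_perturbation w v0neg.
  have eC : e^* = e by rewrite geC0_conj // ltW.
  have We : W (e *: w) by apply: WZ.
  have WNe : W (- (e *: w)) by rewrite -scaleN1r; apply: WZ => //; rewrite rmorphN1.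
  have e2 : 2 * (e ^+ 2) != 0 by rewrite mulf_neq0 ?pnatr_eq0 ?expf_neq0 // gt_eqF.
  apply: (mulfI e2); rewrite mulr0.
  (* parallelogram law for the quadratic form [Q] *)
  transitivity (Q (v0 + e *: w) + Q (v0 - e *: w) - 2 * Q v0).
    by rewrite /Q !hformE eC !rmorphD !rmorphN !rmorphM /= eC; form_ring.
  by rewrite !Qneg //; [ring | exact: WD | exact: WD].
have quad j k :
    h Z Z * (h Y (col j P) * (h Y (col k P))^* +
             h Y (col k P) * (h Y (col j P))^*) =
    h Y Y * (h Z (col j P) * (h Z (col k P))^* +
             h Z (col k P) * (h Z (col j P))^*).
  apply/eqP; rewrite -subr_eq0; apply/eqP.
  transitivity (Q (col j P + col k P) - Q (col j P) - Q (col k P)).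
    by rewrite /Q !hformE !rmorphD /=; form_ring.
  by rewrite !Q0 ?subr0 //; exact: WD.
have [] := proportional_or_conj (negbT (lt_eqF Yneg)) (negbT (lt_eqF Zneg))
  (fun j k => esym (quad j k)).
move=> c YZ.
have mirror : Y = c *: Z \/ Y = c *: anti M Z.
  case: YZ => YZ; [left | right]; apply/eqP; rewrite -subr_eq0; apply/eqP;
    apply: (form_nondegenerate hJ uP) => i; rewrite !hformE YZ.
    by rewrite subrr.
  have /WM colM := WcolP i.
  by rewrite -{2}colM hform_antiunitary // subrr.
have c0 : c != 0.
  by apply: contraNneq Y0 => c0; case: mirror => ->; rewrite c0 scale0r.
case: mirror => YE; last by rewrite spY YE span_scale.
have sp : s p = p by apply: H2_eq; rewrite spY YE span_scale // pZ.
have : [set p | s p = p] p by [].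
rewrite fixW => -[v /WM Mv pv]; rewrite sp pv.
have [d d0 ->] := span_eq Z0 (etrans (esym pZ) pv).
by rewrite antiZ span_scale ?conjC_eq0 // Mv.
Qed.
End Lifts.

(** * Involutions that exchange the vertices of a square *)

Lemma ord4_ind (P : 'I_4 -> Prop) :
  P 0 -> P 1 -> P 2 -> P 3 -> forall i, P i.
Proof.
move=> p0 p1 p2 p3 [[|[|[|[|//]]]] ilt].
- by rewrite (_ : Ordinal ilt = 0) //; exact: val_inj.
- by rewrite (_ : Ordinal ilt = 1) //; exact: val_inj.
- by rewrite (_ : Ordinal ilt = 2) //; exact: val_inj.
- by rewrite (_ : Ordinal ilt = 3) //; exact: val_inj.
Qed.

Section Involution.
Variables (R : realType) (J : 'M[Cplx R]_3).
Hypothesis hJ : signature21 J.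
Local Notation C := (Cplx R).
Local Notation h := (hform J).
Local Notation "M ^c" := (map_mx Num.conj M).
Implicit Types (a b c : C) (x y z v : 'cV[C]_3) (M N P A B S : 'M[C]_3).

(** The antilinear map of [S] conjugates [A] and [B] to their inverses: its
    composites with [A] and [B] are involutions, as it is itself.  Then
    [A = S (S A)] and [B = S (S B)] are products of antiunitary involutions. *)
Definition inverting A B S : Prop :=
  [/\ antiunitary J S, S *m S^c = 1%:M,
      (S *m A^c) *m (S *m A^c)^c = 1%:M &
      (S *m B^c) *m (S *m B^c)^c = 1%:M].

Lemma invertingC A B S : inverting A B S -> inverting B A S.
Proof. by case. Qed.

Lemma invertingP A B S x1 x2 y1 y2 z1 z2 :
  isometry J A -> isometry J B -> antiunitary J S ->
  [/\ x1 != 0, forall c, x2 <> c *: x1, h x1 x1 <= 0 & h x2 x2 <= 0] ->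
  [/\ y1 != 0, forall c, y2 <> c *: y1, h y1 y1 <= 0 & h y2 y2 <= 0] ->
  [/\ z1 != 0, forall c, z2 <> c *: z1, h z1 z1 <= 0 & h z2 z2 <= 0] ->
  anti S (anti S x1) = x1 -> anti S (anti S x2) = x2 ->
  anti S (A *m anti S (A *m y1)) = y1 -> anti S (A *m anti S (A *m y2)) = y2 ->
  anti S (B *m anti S (B *m z1)) = z1 -> anti S (B *m anti S (B *m z2)) = z2 ->
  inverting A B S.
Proof.
move=> hA hB hS [x0 x12 hx1 hx2] [y0 y12 hy1 hy2] [z0 z12 hz1 hz2].
move=> Sx1 Sx2 Ay1 Ay2 Bz1 Bz2; split=> //.
- exact: (antiunitary_involution hJ hS x0 x12).
- by apply: (antiunitary_involution hJ (antiunitary_mulr hS hA) y0 y12 hy1 hy2);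
    rewrite -!anti_mul; [exact: Ay1 | exact: Ay2].
- by apply: (antiunitary_involution hJ (antiunitary_mulr hS hB) z0 z12 hz1 hz2);
    rewrite -!anti_mul; [exact: Bz1 | exact: Bz2].
Qed.

(** If [v1] is an eigenvector of [A B A^-1 B^-1] with eigenvalue [r * r], then
    [v2 = B^-1 v1], [v3 = A^-1 v2] and [v4 = A^-1 v1] satisfy the relations
    below: [A] maps the edge [v3 v4] to [v2 v1], and [B] maps the edge [v3 v2]
    to [v4 v1], up to the factor [r * r]. *)
Section Square.
Variables (A B : 'M[C]_3) (v1 v2 v3 v4 : 'cV[C]_3) (r q : C).
Hypotheses (hA : isometry J A) (hB : isometry J B) (r_gt0 : 0 < r).
Hypotheses (v10 : v1 != 0) (q1 : h v1 v1 = q) (qneg : q <= 0).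
Hypotheses (A3 : A *m v3 = v2) (A4 : A *m v4 = v1).
Hypotheses (B2 : B *m v2 = v1) (B3 : B *m v3 = (r * r) *: v4).

Let r0 : r != 0. Proof. by rewrite gt_eqF. Qed.
Let rC : r^* = r. Proof. by rewrite geC0_conj // ltW. Qed.
Let rrC : (r * r)^* = r * r. Proof. by rewrite rmorphM /= rC. Qed.
Let qC : q^* = q. Proof. by rewrite -q1 -(hformC hJ). Qed.
Let q2 : h v2 v2 = q. Proof. by rewrite -(hform_isometry _ _ hB) B2. Qed.
Let q4 : h v4 v4 = q. Proof. by rewrite -(hform_isometry _ _ hA) A4. Qed.
Let q3 : h v3 v3 = q. Proof. by rewrite -(hform_isometry _ _ hA) A3 q2. Qed.

(** Going around the square both preserves the norm [q] and multiplies it by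
    the square of [r * r]: either [q = 0] or [r = 1]. *)
Let rrq : r * (r * q) = q.
Proof.
have := hform_isometry v3 v3 hB; rewrite B3 !hformE q3 q4 rrC => e.
apply/eqP; rewrite -subr_eq0.
have r1 : r * r + 1 != 0 by rewrite gt_eqF // addr_gt0 // mulr_gt0.
rewrite -(mulrI_eq0 _ (mulfI r1)).
have -> : (r * r + 1) * (r * (r * q) - q) = r * r * (r * r * q) - q by ring.
by rewrite e subrr.
Qed.

Let rVrVq : r^-1 * (r^-1 * q) = q.
Proof. by rewrite -{1}rrq; field. Qed.

Let v20 : v2 != 0.
Proof. by apply: contraNneq v10 => e; rewrite -B2 e mulmx0. Qed.
Let v40 : v4 != 0.
Proof. by apply: contraNneq v10 => e; rewrite -A4 e mulmx0. Qed.
Let v30 : v3 != 0.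
Proof. by apply: contraNneq v20 => e; rewrite -A3 e mulmx0. Qed.

(** The exchange of opposite vertices conjugates the Gram matrix, so it extends
    to an antiunitary [S].  Its square fixes the edge [v3 v4], as does that of
    [S A], and the square of [S B] fixes the edge [v3 v2]. *)
Lemma inverting_of_proper_square :
  (forall c, v4 <> c *: v3) -> (forall c, v2 <> c *: v3) ->
  exists S, inverting A B S.
Proof.
move=> v34 v32.
have g34 : h v3 v4 = h v2 v1 by rewrite -(hform_isometry _ _ hA) A3 A4.
have g43 : h v4 v3 = h v1 v2 by rewrite -(hform_isometry _ _ hA) A3 A4.
have g23 : h v2 v3 = r * r * h v1 v4.
  by rewrite -(hform_isometry _ _ hB) B2 B3 hformZr rrC.
have g32 : h v3 v2 = r * r * h v4 v1.
  by rewrite -(hform_isometry _ _ hB) B2 B3 hformZl.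
have C12 := hformC hJ v2 v1; have C13 := hformC hJ v3 v1.
have C14 := hformC hJ v4 v1; have C24 := hformC hJ v4 v2.
have [||||i j|S hS SX] := antiunitary_extension hJ
  (X := fun i : 'I_4 => nth 0 [:: v3; v4; v1; v2] i)
  (Y := fun i : 'I_4 => nth 0 [:: r *: v1; r^-1 *: v2; r^-1 *: v3; r *: v4] i)
  (i1 := 0) (i2 := 1).
- exact: v30.
- exact: v34.
- by rewrite /= q3.
- by rewrite /= q4.
- elim/ord4_ind: i; elim/ord4_ind: j;
    rewrite ?hformZl ?hformZr ?fmorphV /= ?q1 ?q2 ?q3 ?q4 ?g34 ?g43 ?g23 ?g32
      ?C12 ?C13 ?C14 ?C24 ?rmorphM /= ?conjCK ?rC ?qC;
    match goal with
    | |- r * _ = q => exact: rrq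
    | |- _ = q => exact: rVrVq
    | _ => by field
    end.
have S3 : anti S v3 = r *: v1 by exact: (SX 0).
have S4 : anti S v4 = r^-1 *: v2 by exact: (SX 1).
have S1 : anti S v1 = r^-1 *: v3 by exact: (SX 2).
have S2 : anti S v2 = r *: v4 by exact: (SX 3).
exists S; apply: (@invertingP A B S v3 v4 v3 v4 v3 v2);
  rewrite ?q1 ?q2 ?q3 ?q4 //.
- by rewrite S3 antiZ S1 scalerA rC mulfV // scale1r.
- by rewrite S4 antiZ S2 scalerA fmorphV /= rC mulVf // scale1r.
- by rewrite A3 S2 -scalemxAr A4 antiZ S1 scalerA rC mulfV // scale1r.
- by rewrite A4 S1 -scalemxAr A3 antiZ S2 scalerA fmorphV /= rC mulVf // scale1r.
- rewrite B3 antiZ S4 scalerA rrC -scalemxAr B2 antiZ S1 scalerA.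
  by rewrite rmorphM fmorphV /= rrC rC mulfK // mulfV // scale1r.
- rewrite B2 S1 -scalemxAr B3 scalerA antiZ S4 scalerA.
  by rewrite rmorphM fmorphV /= rrC rC mulKf // mulfV // scale1r.
Qed.

(** Here [v1], [v2] span one line and [v3], [v4] another, both fixed by [B].
    The exchange of [v1] and [v3] is prolonged to the vector [A v1], which has
    to go to [r^-1 *: A^-1 v3] for the square of [S A] to fix [v1]. *)
Lemma inverting_of_collapsed_square c : v4 = c *: v3 ->
  (forall d, v3 <> d *: v1) -> A \in unitmx -> exists S, inverting A B S.
Proof.
move=> v43 v13 uA.
have c0 : c != 0 by apply: contraNneq v40 => c0; rewrite v43 c0 scale0r.
have v1E : v1 = c *: v2 by rewrite -A4 v43 -scalemxAr A3.
have v2E : v2 = c^-1 *: v1 by rewrite v1E scalerA mulVf // scale1r.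
have B1 : B *m v1 = c *: v1 by rewrite {1}v1E -scalemxAr B2.
have B3' : B *m v3 = (r * r * c) *: v3 by rewrite B3 v43 scalerA.
have A3' : A *m v3 = c^-1 *: v1 by rewrite A3 v2E.
have t0 : h v1 v3 != 0.
  apply/eqP => t0; have [||d] := nonpos_orth_colinear hJ v10 _ _ t0.
  - by rewrite q1.
  - by rewrite q3.
  - exact: v13.
have rrcc : r * r * (c * c^*) = 1.
  apply: (mulIf t0); rewrite mul1r -{2}(hform_isometry _ _ hB) B1 B3' !hformE.
  by rewrite rmorphM /= rrC; ring.
have [w Aw] : exists w, A *m w = v3 by exists (invmx A *m v3); rewrite mulKVmx.
have [z zE] : exists z, z = A *m v1 by exists (A *m v1).
have cc0 : c^* != 0 by rewrite conjC_eq0.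
have qw : h w w = q by rewrite -(hform_isometry _ _ hA) Aw q3.
have qz : h z z = q by rewrite zE hform_isometry.
have z1 : h z v1 = c^* * h v1 v3.
  by rewrite zE {2}v1E hformZr -A3 hform_isometry.
have w3 : h w v3 = (c^-1)^* * h v3 v1.
  by rewrite -(hform_isometry _ _ hA) Aw A3' hformZr.
have w1 : h w v1 = h v3 z by rewrite -(hform_isometry _ _ hA) Aw zE.
have rVrV : r^-1 * r^-1 = c * c^*.
  by apply: (mulfI (mulf_neq0 r0 r0)); rewrite rrcc; field.
have C31 := hformC hJ v3 v1; have Cz3 := hformC hJ v3 z.
have C1z := hformC hJ v1 z.
have C3w := hformC hJ v3 w; have C1w := hformC hJ v1 w.
have [||||i j|S hS SX] := antiunitary_extension hJ
  (X := fun i : 'I_3 => nth 0 [:: v1; v3; z] i)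
  (Y := fun i : 'I_3 => nth 0 [:: r^-1 *: v3; r *: v1; r^-1 *: w] i)
  (i1 := 0) (i2 := 1).
- exact: v10.
- exact: v13.
- by rewrite /= q1.
- by rewrite /= q3.
- elim/ord3_ind: i; elim/ord3_ind: j;
    rewrite ?hformZl ?hformZr ?fmorphV /= ?q1 ?q3 ?qz ?qw ?z1 ?w3 ?w1
      ?C1z ?C3w ?C1w ?z1 ?w3 ?w1 ?Cz3 ?C31 ?rmorphM ?fmorphV /= ?conjCK ?rC ?qC;
    match goal with
    | |- r * _ = q => exact: rrq
    | |- r^-1 * _ = q => exact: rVrVq
    | |- r^-1 * (r^-1 * _) = _ => rewrite mulrA rVrV; by field
    | _ => by field
    end.
have S1 : anti S v1 = r^-1 *: v3 by exact: (SX 0).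
have S3 : anti S v3 = r *: v1 by exact: (SX 1).
have Sz : anti S z = r^-1 *: w by exact: (SX 2).
exists S; apply: (@invertingP A B S v1 v3 v1 v3 v1 v3); rewrite ?q1 ?q3 //.
- by rewrite S1 antiZ S3 scalerA fmorphV /= rC mulVf // scale1r.
- by rewrite S3 antiZ S1 scalerA rC mulfV // scale1r.
- by rewrite -zE Sz -scalemxAr Aw antiZ S3 scalerA fmorphV /= rC mulVf // scale1r.
- rewrite A3' antiZ S1 scalerA -scalemxAr A3' !scalerA antiZ S1 scalerA.
  have -> : (c^-1^* * r^-1 / c)^* * r^-1 = r^-1 * r^-1 / (c * c^*).
    by rewrite !rmorphM !fmorphV /= rC conjCK invfM; ring.
  by rewrite rVrV divff ?mulf_neq0 // scale1r.
- rewrite B1 antiZ S1 scalerA -scalemxAr B3' scalerA antiZ S3 scalerA.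
  have -> : (c^* / r * (r * r * c))^* * r = r * r * (c * c^*).
    by rewrite !rmorphM !fmorphV /= !conjCK rC; field.
  by rewrite rrcc scale1r.
- rewrite B3' antiZ S3 scalerA -scalemxAr B1 scalerA antiZ S1 scalerA.
  have -> : ((r * r * c)^* * r * c)^* / r = r * r * (c * c^*).
    by rewrite !rmorphM /= !conjCK rC; field.
  by rewrite rrcc scale1r.
Qed.
End Square.
End Involution.

(** * The decomposition theorem *)

Section Decomposition.
Variables (R : realType) (J : 'M[Cplx R]_3).
Hypothesis hJ : signature21 J.
Local Notation C := (Cplx R).
Local Notation h := (hform J).
Local Notation "M ^c" := (map_mx Num.conj M).
Implicit Types (a b c lam : C) (x y z v : 'cV[C]_3) (M N P A B S : 'M[C]_3).

Lemma inverting_exists A B v lam :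
  isometry J A -> isometry J B -> A \in unitmx -> B \in unitmx ->
  (forall x a b, x != 0 -> h x x <= 0 -> A *m x = a *: x -> B *m x = b *: x ->
     False) ->
  v != 0 -> h v v <= 0 ->
  A *m B *m invmx A *m invmx B *m v = lam *: v -> 0 < lam ->
  exists S, inverting J A B S.
Proof.
move=> hA hB uA uB nofix v0 vneg comm lam0.
have preimage M x : M \in unitmx -> exists y, M *m y = x.
  by move=> uM; exists (invmx M *m x); rewrite mulKVmx.
have [v2 B2] := preimage B v uB; have [v3 A3] := preimage A v2 uA.
have [v4 A4] := preimage A v uA.
have [r r0 lamE] : exists2 r : C, 0 < r & lam = r * r.
  by exists (sqrtC lam); rewrite ?sqrtC_gt0 // -expr2 sqrtCK.
have B3 : B *m v3 = (r * r) *: v4.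
  apply: (can_inj (mulKmx uA)); rewrite -scalemxAr A4 -lamE -comm -!mulmxA.
  by rewrite -B2 mulKmx // -A3 mulKmx.
have v20 : v2 != 0 by apply: contraNneq v0 => e; rewrite -B2 e mulmx0.
have v30 : v3 != 0 by apply: contraNneq v20 => e; rewrite -A3 e mulmx0.
have v40 : v4 != 0 by apply: contraNneq v0 => e; rewrite -A4 e mulmx0.
have scale_neq0 x y c : x != 0 -> x = c *: y -> c != 0.
  by move=> x0 xy; apply: contraNneq x0 => c0; rewrite xy c0 scale0r.
case: (pselect (exists c, v4 = c *: v3)) => [[c v43]|/forallNP v43].
  have c0 := scale_neq0 _ _ _ v40 v43.
  apply: (inverting_of_collapsed_square hJ hA hB r0 v0 erefl vneg A3 A4 B2 B3 v43)
    => // d v31.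
  have d0 := scale_neq0 _ _ _ v30 v31.
  apply: (nofix v (d^-1 * c^-1) c) => //.
    apply: (scalerI d0); apply: (scalerI c0); rewrite scalemxAr -v31 A3.
    rewrite !scalerA -!mulrA mulVKf // mulfV // scale1r.
    by rewrite -A4 v43 -scalemxAr A3.
  by rewrite -[in LHS]A4 v43 -scalemxAr A3 -scalemxAr B2.
case: (pselect (exists c, v2 = c *: v3)) => [[c v23]|/forallNP v23]; last first.
  exact: (inverting_of_proper_square hJ hA hB r0 v0 erefl vneg A3 A4 B2 B3).
(* Exchanging [A] and [B] replaces the eigenvalue by its inverse and swaps
   [v2] and [v4]. *)
have c0 := scale_neq0 _ _ _ v20 v23.
have rr0 : r * r != 0 by rewrite mulf_neq0 ?gt_eqF.
have [v3' v3E] : exists v3', v3 = (r * r) *: v3'.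
  by exists ((r * r)^-1 *: v3); rewrite scalerA mulfV // scale1r.
have B3' : B *m v3' = v4.
  by apply: (scalerI rr0); rewrite -B3 v3E scalemxAr.
have A3' : A *m v3' = (r^-1 * r^-1) *: v2.
  by apply: (scalerI rr0); rewrite scalemxAr -v3E A3 scalerA -invfM mulfV // scale1r.
have v23' : v2 = (c * (r * r)) *: v3' by rewrite -scalerA -v3E.
have rV0 : 0 < r^-1 by rewrite invr_gt0.
have [|S hS] := inverting_of_collapsed_square hJ hB hA rV0 v0 erefl vneg
  B3' B2 A4 A3' v23' _ uB; last by exists S; apply: invertingC.
move=> d v31.
have {}v31 : v3 = (r * r * d) *: v by rewrite -scalerA -v31.
have e0 := scale_neq0 _ _ _ v30 v31; move: (r * r * d) => e in v31 e0.
have v2v : v2 = (c * e) *: v by rewrite v23 v31 scalerA.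
apply: (nofix v c (c * e)^-1) => //.
  by apply: (scalerI e0); rewrite scalemxAr -v31 A3 v2v scalerA mulrC.
apply: (scalerI (mulf_neq0 c0 e0)).
by rewrite scalemxAr -v2v B2 scalerA (mulfV (mulf_neq0 c0 e0)) scale1r.
Qed.

Lemma act_line (M : U21 J) (p : CP2 R) z :
  line p = <[z]>%VS -> line (act (toPU M) p) = <[U21mx M *m z]>%VS.
Proof. by move=> pz; rewrite act_toPU (U21_act_span _ pz). Qed.

Lemma act_fixed (M : U21 J) (p : CP2 R) z a : z != 0 ->
  line p = <[z]>%VS -> U21mx M *m z = a *: z -> act (toPU M) p = p.
Proof.
move=> z0 pz Mz; apply: CP2_eq; rewrite (act_line _ pz) Mz pz span_scale //.
apply: contraNneq z0 => a0.
by rewrite -(mulKmx (U21_unit M) z) Mz a0 scale0r mulmx0.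
Qed.

Lemma commutator_toPU (MA MB : U21 J) :
  commutator (toPU MA) (toPU MB) = toPU (commutator MA MB).
Proof. by rewrite /commutator !toPUM !toPUV. Qed.

Lemma commutator_eigenvalue_toPU (MA MB : U21 J) (p : CP2 R) z lam :
  z != 0 -> line p = <[z]>%VS ->
  commutator_eigenvalue (toPU MA) (toPU MB) p lam <->
  U21mx (commutator MA MB) *m z = lam *: z.
Proof.
move=> z0 pz; split=> [|e MA' MB' eA eB P P0].
  by apply=> //; rewrite pz memv_line.
rewrite (commutator_lift eA eB) pz => /vlineP [c ->].
by rewrite -scalemxAr e !scalerA mulrC.
Qed.

(** A lift is determined up to a scalar by the action on negative lines.  The
    last equation says that the antilinear map of [M1] conjugates [X] to its
    inverse. *)
Lemma lift_reflection_product (M : U21 J) (s1 s2 : H2 J -> H2 J) M1 M2 :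
  antiunitary J M1 -> antiunitary J M2 ->
  M1 *m M1^c = 1%:M -> M2 *m M2^c = 1%:M ->
  anti_lift s1 M1 -> anti_lift s2 M2 ->
  (forall p : H2 J, act (toPU M) (\val p) = \val (s1 (s2 p))) ->
  exists k X, [/\ isometry J X, U21mx M = k *: X &
                  X *m (M1 *m X^c *m M1^c) = 1%:M].
Proof.
move=> h1 h2 i1 i2 l1 l2 Mp.
have [X XE] : exists X, X = M1 *m M2^c by exists (M1 *m M2^c).
have hX : isometry J X by rewrite XE; apply: antiunitary_mul_conj.
have XX : X *m (M1 *m X^c *m M1^c) = 1%:M.
  rewrite XE conjmx_mul conjmxK !mulmxA -(mulmxA _ M1 M1^c) i1 mulmx1.
  by rewrite -(mulmxA M1) (mulmx1C i2) mulmx1.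
have XX' := mulmx1C XX.
have [z zneg|k Mk] := @scalar_of_neg_eigenvectors R J hJ
    (M1 *m X^c *m M1^c *m U21mx M).
  have [p pz] := H2_point zneg.
  have := Mp p; move/(congr1 (@line R)).
  rewrite (act_line _ pz) (l1 _ _ (l2 _ _ pz)) anti_anti -XE.
  have Mz0 : U21mx M *m z != 0.
    apply: contraNneq (neg_neq0 zneg) => e.
    by rewrite -(mulKmx (U21_unit M) z) e mulmx0.
  move/(span_eq Mz0) => [c c0 e]; exists c.
  by rewrite -mulmxA e -scalemxAr mulmxA XX' mul1mx.
exists k, X; split => //; rewrite -[LHS]mul1mx -XX -mulmxA Mk.
by rewrite mul_mx_scalar.
Qed.

(** With [T = s1 s2 s1 s3 s1] as an antiunitary map, [T^2] is exactly the
    commutator of the lifts of [s1 s2] and [s1 s3]. *)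
Lemma decomposable_pos_eigenvector (MA MB : U21 J) :
  R_decomposable (toPU MA) (toPU MB) ->
  exists v lam, [/\ v != 0, h v v <= 0, 0 < lam &
    U21mx (commutator MA MB) *m v = lam *: v].
Proof.
move=> [s1 [s2 [s3 [r1 r2 r3 eA eB]]]].
have [M1 [h1 i1 l1]] := real_reflection_lift hJ r1.
have [M2 [h2 i2 l2]] := real_reflection_lift hJ r2.
have [M3 [h3 i3 l3]] := real_reflection_lift hJ r3.
have [a [X [hX MAE XX]]] := lift_reflection_product h1 h2 i1 i2 l1 l2 eA.
have [b [Y [hY MBE YY]]] := lift_reflection_product h1 h3 i1 i3 l1 l3 eB.
have inv (M : U21 J) k N N' : U21mx M = k *: N -> N *m N' = 1%:M ->
    k != 0 /\ invmx (U21mx M) = k^-1 *: N'.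
  move=> Mk NN; have k0 : k != 0.
    by apply: contraNneq (U21_neq0 M) => k0; rewrite Mk k0 scale0r.
  split=> //; apply: (can_inj (mulKmx (U21_unit M))).
  by rewrite mulmxV ?U21_unit // Mk -scalemxAl -scalemxAr scalerA mulfV // NN scale1r.
have [a0 VA] := inv _ _ _ _ MAE XX; have [b0 VB] := inv _ _ _ _ MBE YY.
have hT : antiunitary J (X *m Y *m M1).
  by apply: isometry_anti_mul => //; apply: isometry_mul.
have TT : U21mx (commutator MA MB) = X *m Y *m M1 *m (X *m Y *m M1)^c.
  transitivity (X *m Y *m (M1 *m X^c *m M1^c) *m (M1 *m Y^c *m M1^c)).
    rewrite /= VA VB MAE MBE -!(scalemxAl, scalemxAr) !scalerA.
    have -> : a * (b^-1 / a * b) = 1 by field; rewrite a0 b0.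
    by rewrite scale1r.
  by rewrite !conjmx_mul !mulmxA -(mulmxA _ M1^c M1) (mulmx1C i1) mulmx1.
have [v [lam [v0 vneg e lam0]]] := antiunitary_pos_eigenvector hJ hT.
by exists v, lam; rewrite TT.
Qed.

Lemma inverting_decomposable (MA MB : U21 J) S :
  inverting J MA MB S -> R_decomposable (toPU MA) (toPU MB).
Proof.
move=> [hS SS SA SB].
have hSM (M : U21 J) : antiunitary J (S *m (U21mx M)^c).
  exact: antiunitary_mulr hS (isometry_unitary21 M).
have [s1 l1] := anti_lift_exists hJ hS.
have [s2 l2] := anti_lift_exists hJ (hSM MA).
have [s3 l3] := anti_lift_exists hJ (hSM MB).
have prod (M : U21 J) s (p : H2 J) : anti_lift s (S *m (U21mx M)^c) ->
    act (toPU M) (\val p) = \val (s1 (s p)).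
  move=> l; have [_ pz] := CP2_span (\val p); apply: CP2_eq.
  rewrite (act_line _ pz) (l1 _ _ (l _ _ pz)) anti_anti.
  by rewrite conjmx_mul conjmxK mulmxA SS mul1mx.
exists s1, s2, s3; split; try (by move=> p; apply: prod).
- exact (anti_lift_real_reflection hJ hS SS l1).
- exact (anti_lift_real_reflection hJ (hSM MA) SA l2).
- exact (anti_lift_real_reflection hJ (hSM MB) SB l3).
Qed.
End Decomposition.

Theorem theorem4p1 (R : realType) (J : 'M[Cplx R]_3) (hJ : signature21 J)
    (A B : PU21 J)
    (no_common_fixed_point :
       ~ exists p : CP2 R, [/\ clH2 J p, act A p = p & act B p = p]) :
  R_decomposable A B <->
  exists p : CP2 R,
    [/\ clH2 J p,
        act (commutator A B) p = p &
        exists lam : Cplx R, commutator_eigenvalue A B p lam /\ 0 < lam].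
Proof.
have [MA eA] := toPU_surj A; have [MB eB] := toPU_surj B.
move: no_common_fixed_point; rewrite -eA -eB => nofix; split.
  move=> /(decomposable_pos_eigenvector hJ) [v [lam [v0 vneg lam0 e]]].
  have pv : line (point v0) = <[v]>%VS by [].
  exists (point v0); split.
  - by apply/clH2_span; exists v.
  - by rewrite commutator_toPU (act_fixed v0 pv e).
  - by exists lam; split=> //; apply/(commutator_eigenvalue_toPU _ _ _ v0 pv).
move=> [p [/clH2_span [v [v0 vneg pv]] _ [lam [elam lam0]]]].
have e := (commutator_eigenvalue_toPU MA MB lam v0 pv).1 elam.
have [|S hS] := inverting_exists hJ
  (isometry_unitary21 MA) (isometry_unitary21 MB) (U21_unit MA) (U21_unit MB) _ v0 vneg e lam0.
  move=> x a b x0 xneg Ax Bx; apply: nofix; exists (point x0).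
  have px : line (point x0) = <[x]>%VS by [].
  split; first by apply/clH2_span; exists x.
    exact: act_fixed x0 px Ax.
  exact: act_fixed x0 px Bx.
exact (inverting_decomposable hJ hS).
Qed.
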